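(* Let $A$ be a finite set of complex variables, $\alpha^*,\beta^*\in A$, $A'=A\setminus\{\alpha^*,\beta^*\}$, and regard $J^*_{USp(2N)}(A)$ as a meromorphic function of the elements of $A$. Then $$\operatorname{Res}_{\alpha^*=-\beta^*}J^*_{USp(2N)}(A)=J^*_{USp(2N)}(A'\cup\{\beta^*\})+J^*_{USp(2N)}(A'\cup\{-\beta^*\})+2N\,J^*_{USp(2N)}(A'),$$ and $\operatorname{Res}_{\alpha^*=0}J^*_{USp(2N)}(A)=0$.
   Context: $z(x)=\frac1{1-e^{-x}}$; $Y(A)=\prod_{\alpha\in A}z(2\alpha)$; $Z(A,B)=\prod_{\alpha\in A,\beta\in B}z(\alpha+\beta)$; $Z^\dagger$ omits factors of zero argument; $D^-=\{-\delta:\delta\in D\}$. For a positive integer $N$, $J^*_{USp(2N)}(A)=\sum_{D\subseteq A}e^{-2N\sum_{\delta\in D}\delta}(-1)^{|D|}\sqrt{\frac{Z(D,D)Z(D^-,D^-)Y(D^-)}{Y(D)Z^{\dagger}(D^-,D)^2}}\sum_{A\setminus D=W_1\cup\cdots\cup W_R}\prod_rH_D(W_r)$, the inner sum over set partitions of $A\setminus D$ into nonempty blocks of size at most 2 (equal to 1 if empty), with $H_D(\{\alpha\})=\sum_{\delta\in D}\left(\frac{z'}{z}(\alpha-\delta)-\frac{z'}{z}(\alpha+\delta)\right)+\frac{z'}{z}(2\alpha)$ and $H_D(\{\alpha,\hat\alpha\})=-\left(\frac{z'}{z}\right)'(\alpha+\hat\alpha)$.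
   Formalization: The sign of H_D on pairs is corrected: H_D({α,α̂}) = +(z'/z)'(α+α̂) instead of −(z'/z)'(α+α̂); with the minus sign the residue formula at α*=−β* already fails when A has three elements. *)

(* Defs.v *)
From HB Require Import structures.
From mathcomp Require Import all_boot all_order all_algebra.
From mathcomp Require Import complex.
From mathcomp Require Import all_classical all_reals all_analysis.
Set Implicit Arguments.
Unset Strict Implicit.
Unset Printing Implicit Defensive.
Import Order.TTheory GRing.Theory Num.Theory numFieldNormedType.Exports.
Local Open Scope classical_set_scope.
Local Open Scope ring_scope.
Local Open Scope complex_scope.

(* R[i] as a numFieldType: it is then a normed module over itself, and
   derivable and derive1 below are complex differentiability and the complex
   derivative. *)
Definition Cplx (R : realType) : numFieldType := R[i].

Definition cexp (R : realType) (x : Cplx R) : Cplx R :=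
  (expR (complex.Re x))%:C
  * (cos (complex.Im x) +i* sin (complex.Im x)).

(* f is meromorphic at c, and the coefficient of 1 / (x - c) in its Laurent
   expansion at c is r. *)
Definition has_residue (R : realType) (f : Cplx R -> Cplx R) (c r : Cplx R) : Prop :=
  exists (m : nat) (p : nat -> Cplx R) (g : Cplx R -> Cplx R),
    [/\ \forall x \near c, derivable g x 1,
        \forall x \near c^',
          f x = \sum_(k < m.+1) p k / (x - c) ^+ k.+1 + g x
      & p 0%N = r].

Definition zfun (R : realType) (x : Cplx R) : Cplx R := (1 - cexp (- x))^-1.

Definition dlogz (R : realType) (x : Cplx R) : Cplx R :=
  derive1 (@zfun R) x / zfun x.

(* A set of complex variables is a set A of indices together with a valuation
   v : T -> Cplx R; the set A^- is A with the valuation - v. *)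
Definition Yprod (R : realType) (T : finType) (A : {set T})
    (v : T -> Cplx R) : Cplx R :=
  \prod_(a in A) zfun (2 * v a).

Definition Zprod (R : realType) (T : finType) (A B : {set T})
    (u v : T -> Cplx R) : Cplx R :=
  \prod_(a in A) \prod_(b in B) zfun (u a + v b).

Definition Zdag (R : realType) (T : finType) (A B : {set T})
    (u v : T -> Cplx R) : Cplx R :=
  \prod_(a in A) \prod_(b in B | u a + v b != 0) zfun (u a + v b).

Definition neg_val (R : realType) (T : finType) (v : T -> Cplx R) : T -> Cplx R :=
  fun t => - v t.

(* The values on A avoid the polar hyperplanes: a + b (including 2 a) and
   a - b, for a != b, are not in 2 pi i Z. *)
Definition generic (R : realType) (T : finType) (A : {set T})
    (v : T -> Cplx R) : Prop :=
  (forall a b, a \in A -> b \in A -> cexp (v a + v b) != 1) /\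
  (forall a b, a \in A -> b \in A -> a != b -> cexp (v a - v b) != 1).

Definition radicand (R : realType) (T : finType) (D : {set T})
    (v : T -> Cplx R) : Cplx R :=
  Zprod D D v v * Zprod D D (neg_val v) (neg_val v) * Yprod D (neg_val v)
  / (Yprod D v * Zdag D D (neg_val v) v ^+ 2).

(* The radicand is the square of a meromorphic function of the variables in D.
   Its square root is the meromorphic one, i.e. holomorphic in each variable
   off the polar hyperplanes, so it is determined up to a global sign. That
   sign is the one for which
     sqrt (Z(D^-,D^-) Y(D^-)) = prod_(j <= k) z (- d_j - d_k),
     sqrt (Z(D,D) / Y(D)) = prod_(j < k) z (d_j + d_k),
     sqrt (Z^dag(D^-,D)^2) = Z^dag(D^-,D),
   equivalently the root is positive when all the variables are negative
   reals: z (x) z (- x) < 0 for every real x != 0, z (d_j + d_k) z (- d_j - d_k)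
   and z (d_j - d_k) z (d_k - d_j) occur once for each j < k, and
   z (- 2 d) > 0 for d < 0. (Order on Cplx R: 0 < x means that x is a positive
   real.) *)
Definition sqrt_branch (R : realType) (T : finType) (D : {set T})
    (s : (T -> Cplx R) -> Cplx R) : Prop :=
  [/\ forall v, generic D v -> s v ^+ 2 = radicand D v,
      forall v t, generic D v -> t \in D ->
        derivable (fun x => s [eta v with t |-> x]) (v t) 1
    & forall v, generic D v -> (forall t, t \in D -> v t < 0) -> 0 < s v].

Definition sqrt_radicand (R : realType) (T : finType) (D : {set T}) :
    (T -> Cplx R) -> Cplx R :=
  xget (fun=> 0) [set s | sqrt_branch D s].

(* Only blocks W of size 1 or 2 matter; in the first case the sum over W has a
   single term, and in the second case the sum in the argument of (z'/z)' is
   the sum of the two elements of the block.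
   The value on a pair {a, b} is + (z'/z)'(a + b), the mixed second derivative
   of log z (a + b) in a and b. This corrects a sign: the source has
   - (z'/z)'(a + b), for which the residue formula at a = - b already fails for
   three variables. *)
Definition Hblock (R : realType) (T : finType) (D : {set T}) (v : T -> Cplx R)
    (W : {set T}) : Cplx R :=
  if #|W| == 1%N then
    \sum_(a in W)
      (\sum_(d in D) (dlogz (v a - v d) - dlogz (v a + v d)) + dlogz (2 * v a))
  else derive1 (@dlogz R) (\sum_(a in W) v a).

Definition Jstar (R : realType) (T : finType) (N : nat) (A : {set T})
    (v : T -> Cplx R) : Cplx R :=
  \sum_(D : {set T} | D \subset A)
    cexp (- ((2 * N)%:R * \sum_(d in D) v d)) * (-1) ^+ #|D|
    * sqrt_radicand D v
    * \sum_(P : {set {set T}} |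
             finset.partition P (A :\: D) && [forall W in P, (#|W| <= 2)%N])
        \prod_(W in P) Hblock D v W.

(* Main.v *)
(** Put [w x = z x * z (- x)]. Then [z'/z = 1 - z] and [(z'/z)' = - w], so every
    summand is a rational expression in exponentials; the square root attached to
    [D] is [prod_d z (- 2 d) * prod_(d, e) (w (d + e) / w (d - e))], the second product
    being over unordered pairs. No other branch is possible: in each variable
    the ratio of two branches is locally constant off isolated points.

    Let [alpha] tend to [- beta] and group the subsets [D] by their trace on
    [{alpha, beta}]. If neither point is in [D], the block [{alpha, beta}] gives
    a double pole without residue. If exactly one is in [D], the simple pole of
    [z'/z (alpha + beta)] gives the terms of the first two values of [J] in
    which [beta] or [- beta] is in [D]. If both are in [D],
    the factor [w (alpha + beta)] has a double pole and the residue is the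
    derivative of its cofactor: the exponential gives [2 N J (A')], the rest
    gives the terms in which [beta] and [- beta] are not in [D]. As [alpha]
    tends to 0, the poles of [z (- 2 alpha)] (for [alpha] in [D]) and of
    [z'/z (2 alpha)] (for [alpha] not in [D]) cancel.

    To avoid Cauchy theory, Laurent expansions are obtained from second-order
    expansions with a differentiable remainder; these are stable under the field
    operations, and exist for the exponential by the mean value inequality. *)

Require Import Defs.
From mathcomp Require Import all_boot all_order all_algebra.
From mathcomp Require Import complex ring lra.
From mathcomp Require Import all_classical all_reals all_analysis.
Set Implicit Arguments.
Unset Strict Implicit.
Unset Printing Implicit Defensive.
Import Order.TTheory GRing.Theory Num.Theory numFieldNormedType.Exports ComplexField.Normc.
Local Open Scope classical_set_scope.
Local Open Scope ring_scope.
Local Open Scope complex_scope.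

(** * Second-order expansions *)

Section Jets.
Variable K : numFieldType.
Implicit Types (c a b : K) (f g : K -> K).

(* An inductive wrapper rather than a definition: derivable unfolds to an
   inclusion of filters, which unification would otherwise explore. *)
Variant cderivable g (x : K) : Prop := CDerivable of derivable g x 1.

Lemma cderivable_cst (k x : K) : cderivable (fun=> k) x.
Proof. by split; exact: derivable_cst. Qed.

Lemma cderivable_id (x : K) : cderivable (fun y => y) x.
Proof. by split; exact: derivable_id. Qed.

Lemma cderivableD f g (x : K) : cderivable f x -> cderivable g x ->
  cderivable (fun y => f y + g y) x.
Proof. by case=> df [dg]; split; exact: derivableD. Qed.

Lemma cderivableB f g (x : K) : cderivable f x -> cderivable g x ->
  cderivable (fun y => f y - g y) x.
Proof. by case=> df [dg]; split; exact: derivableB. Qed.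

Lemma cderivableM f g (x : K) : cderivable f x -> cderivable g x ->
  cderivable (fun y => f y * g y) x.
Proof. by case=> df [dg]; split; exact: derivableM. Qed.

Lemma cderivableV f (x : K) : f x != 0 -> cderivable f x ->
  cderivable (fun y => (f y)^-1) x.
Proof. by move=> f0 [df]; split; exact: derivableV. Qed.

Lemma cderivableX f (x : K) n : cderivable f x ->
  cderivable (fun y => f y ^+ n) x.
Proof.
move=> df; elim: n => [|n ih].
  have -> : (fun y => f y ^+ 0) = (fun=> 1) by apply/funext => y; rewrite expr0.
  exact: cderivable_cst.
have -> : (fun y => f y ^+ n.+1) = (fun y => f y * f y ^+ n).
  by apply/funext => y; rewrite exprS.
exact: cderivableM.
Qed.

Lemma cderivable_continuous f (x : K) : cderivable f x -> {for x, continuous f}.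
Proof. by case=> df; apply: differentiable_continuous; apply/derivable1_diffP. Qed.

(** The remainder is differentiable on a full neighbourhood of [c], but the equation is only asked
    off [c]: the junk value that [f] may take at a removable singularity is ignored. *)
Definition jet c f a b : Prop :=
  exists2 g, (\forall x \near c, cderivable g x) &
    \forall x \near c^', f x = a + b * (x - c) + (x - c) ^+ 2 * g x.

Lemma jet_near c f g a b :
  (\forall x \near c^', f x = g x) -> jet c f a b -> jet c g a b.
Proof.
move=> fg [r dr fr]; exists r => //.
by move: fg fr; apply: filterS2 => x ->.
Qed.

Lemma jet_ext c f g a b : f =1 g -> jet c f a b -> jet c g a b.
Proof. by move=> /funext ->. Qed.

Lemma jet_cst c a : jet c (fun=> a) a 0.
Proof.
exists (fun=> 0); first by apply: filterE => x; exact: cderivable_cst.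
by apply: filterE => x; rewrite mul0r mulr0 !addr0.
Qed.

Lemma jet_eps c : jet c (fun x => x - c) 0 1.
Proof.
exists (fun=> 0); first by apply: filterE => x; exact: cderivable_cst.
by apply: filterE => x; rewrite mul1r mulr0 addr0 add0r.
Qed.

Lemma jetD c f g a b a' b' : jet c f a b -> jet c g a' b' ->
  jet c (fun x => f x + g x) (a + a') (b + b').
Proof.
move=> [r dr fr] [s ds gs]; exists (fun x => r x + s x).
  by move: dr ds; apply: filterS2 => x; exact: cderivableD.
by move: fr gs; apply: filterS2 => x -> ->; ring.
Qed.

Lemma cderivable_shift c (x : K) : cderivable (fun y => y - c) x.
Proof. exact: cderivableB (cderivable_id x) (cderivable_cst c x). Qed.

Lemma cderivableZ k f (x : K) : cderivable f x -> cderivable (fun y => k * f y) x.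
Proof. exact: cderivableM (cderivable_cst k x). Qed.

Lemma jetM c f g a b a' b' : jet c f a b -> jet c g a' b' ->
  jet c (fun x => f x * g x) (a * a') (a * b' + b * a').
Proof.
move=> [r dr fr] [s ds gs].
exists (fun x => b * b' + (a * s x + a' * r x) + (x - c) * (b * s x + b' * r x)
  + (x - c) ^+ 2 * (r x * s x)).
  move: dr ds; apply: filterS2 => x rx sx.
  apply: cderivableD; last first.
    exact: cderivableM (cderivableX 2 (cderivable_shift c x)) (cderivableM rx sx).
  apply: cderivableD; last first.
    exact: cderivableM (cderivable_shift c x)
      (cderivableD (cderivableZ _ sx) (cderivableZ _ rx)).
  exact: cderivableD (cderivable_cst _ x)
    (cderivableD (cderivableZ _ sx) (cderivableZ _ rx)).
by move: fr gs; apply: filterS2 => x -> ->; ring.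
Qed.

Lemma jetZ c f k a b : jet c f a b -> jet c (fun x => k * f x) (k * a) (k * b).
Proof. by move=> /(jetM (jet_cst c k)); rewrite mul0r addr0. Qed.

Lemma jetN c f a b : jet c f a b -> jet c (fun x => - f x) (- a) (- b).
Proof.
move=> /(jetZ (-1)); rewrite !mulN1r; apply: jet_ext => x.
by rewrite mulN1r.
Qed.

Lemma jetB c f g a b a' b' : jet c f a b -> jet c g a' b' ->
  jet c (fun x => f x - g x) (a - a') (b - b').
Proof. by move=> jf /jetN; exact: jetD. Qed.

Lemma near_dnbhs c (P : K -> Prop) :
  (\forall x \near c, P x) -> \forall x \near c^', P x.
Proof. exact: nbhs_dnbhs. Qed.

Lemma near_neq0 f c : cderivable f c -> f c != 0 -> \forall x \near c, f x != 0.
Proof.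
by move=> /cderivable_continuous cf f0; exact: cvgr_neq0 cf f0.
Qed.

(** [F] is the expansion of [f] made into a function differentiable near [c]; it takes the value [a]
    at [c], so it stays nonzero nearby and may be divided by. *)
Lemma jetV c f a b : a != 0 -> jet c f a b ->
  jet c (fun x => (f x)^-1) a^-1 (- b / a ^+ 2).
Proof.
move=> a0 [r dr fr].
pose F x := a + b * (x - c) + (x - c) ^+ 2 * r x.
have dF x : cderivable r x -> cderivable F x.
  move=> rx; apply: cderivableD.
    exact: cderivableD (cderivable_cst _ x) (cderivableZ _ (cderivable_shift c x)).
  exact: cderivableM (cderivableX 2 (cderivable_shift c x)) rx.
have F0 : \forall x \near c, F x != 0.
  apply: near_neq0; first by apply: dF; exact: nbhs_singleton dr.
  by rewrite /F subrr mulr0 addr0 expr0n /= mul0r addr0.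
(* Solve [F x * (a^-1 - b / a ^+ 2 * (x - c) + (x - c) ^+ 2 * g x) = 1] for [g x]. *)
exists (fun x => (b ^+ 2 / a ^+ 2 - a^-1 * r x + (b / a ^+ 2) * ((x - c) * r x)) / F x).
  move: dr F0; apply: filterS2 => x rx Fx.
  apply: cderivableM; last by apply: cderivableV => //; exact: dF.
  apply: cderivableD.
    exact: cderivableB (cderivable_cst _ x) (cderivableZ _ rx).
  exact: cderivableZ (cderivableM (cderivable_shift c x) rx).
move: fr (near_dnbhs F0); apply: filterS2 => x; rewrite -/(F x) => -> Fx.
rewrite -[LHS]mul1r; apply: (canLR (mulfK Fx)).
by rewrite mulrDl mulrA divfK // /F; field.
Qed.

Lemma jet_sum (I : Type) (s : seq I) (P : pred I) c (f : I -> K -> K) (a b : I -> K) :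
  (forall i, P i -> jet c (f i) (a i) (b i)) ->
  jet c (fun x => \sum_(i <- s | P i) f i x) (\sum_(i <- s | P i) a i)
    (\sum_(i <- s | P i) b i).
Proof.
move=> h; elim: s => [|i s ih].
  by rewrite !big_nil; apply: jet_ext (jet_cst c 0) => x; rewrite big_nil.
rewrite !big_cons; case: ifP => Pi; last first.
  by apply: jet_ext ih => x; rewrite big_cons Pi.
by apply: jet_ext (jetD (h i Pi) ih) => x; rewrite big_cons Pi.
Qed.

(** First-order coefficients are given as value times logarithmic derivative; these derivatives then
    add up, without any division by the values. *)
Lemma jet_prod (I : Type) (s : seq I) (P : pred I) c (f : I -> K -> K) (a l : I -> K) :
  (forall i, P i -> jet c (f i) (a i) (a i * l i)) ->
  jet c (fun x => \prod_(i <- s | P i) f i x) (\prod_(i <- s | P i) a i)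
    (\prod_(i <- s | P i) a i * \sum_(i <- s | P i) l i).
Proof.
move=> h; elim: s => [|i s ih].
  by rewrite !big_nil mulr0; apply: jet_ext (jet_cst c 1) => x; rewrite big_nil.
rewrite !big_cons; case: ifP => Pi; last first.
  by apply: jet_ext ih => x; rewrite big_cons Pi.
have -> : a i * \prod_(j <- s | P j) a j * (l i + \sum_(j <- s | P j) l j)
  = a i * (\prod_(j <- s | P j) a j * \sum_(j <- s | P j) l j)
    + a i * l i * \prod_(j <- s | P j) a j by ring.
by apply: jet_ext (jetM (h i Pi) ih) => x; rewrite big_cons Pi.
Qed.

End Jets.

Section JetResidue.
(** Dividing the expansion by [(x - c) ^+ 2] leaves [a / (x - c) ^+ 2 + b / (x - c) + g x], so the
    first-order coefficient is the residue. Poles of order at most two suffice here. *)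
Lemma jet_residue (R : realType) (f : Cplx R -> Cplx R) (c a b : Cplx R) :
  jet c (fun x => (x - c) ^+ 2 * f x) a b -> has_residue f c b.
Proof.
move=> [g dg fg]; exists 1%N, (fun k => if k == 0%N then b else a), g.
split=> //; first by apply: filterS dg => x [].
have cc : \forall x \near c^', x != c by exact: nbhs_dnbhs_neq.
move: fg cc; apply: filterS2 => x fx; rewrite -subr_eq0 => xc.
rewrite big_ord_recr big_ord_recr big_ord0 /= add0r expr1.
by apply: (mulfI (expf_neq0 2 xc)); rewrite fx; field.
Qed.

End JetResidue.

(** * The exponential and [z] *)

Section ExpRemainder.
Variable R : realType.
Implicit Types (F G : R -> R[i]) (t : R) (h l m : R[i]).

(** Componentwise derivative of a path of a real parameter, so that the real mean value theorem can
    be applied to each component. *)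
Definition path_derive F t l : Prop :=
  is_derive t 1 (fun s => complex.Re (F s)) (complex.Re l) /\
  is_derive t 1 (fun s => complex.Im (F s)) (complex.Im l).

Lemma ReD (x y : R[i]) : complex.Re (x + y) = complex.Re x + complex.Re y.
Proof. by case: x; case: y. Qed.

Lemma ImD (x y : R[i]) : complex.Im (x + y) = complex.Im x + complex.Im y.
Proof. by case: x; case: y. Qed.

Lemma path_derive_eq F G t l m :
  F =1 G -> l = m -> path_derive F t l -> path_derive G t m.
Proof. by move=> /funext -> ->. Qed.

Lemma path_derive_cst l t : path_derive (fun=> l) t 0.
Proof. by split; exact: is_derive_cst. Qed.

Lemma path_deriveD F G t l m : path_derive F t l -> path_derive G t m ->
  path_derive (fun s => F s + G s) t (l + m).
Proof.
move=> [F1 F2] [G1 G2]; split.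
  have -> : (fun s => complex.Re (F s + G s)) =
      (fun s => complex.Re (F s)) + (fun s => complex.Re (G s)).
    by apply/funext => s; rewrite ReD.
  by rewrite ReD; exact: is_deriveD.
have -> : (fun s => complex.Im (F s + G s)) =
    (fun s => complex.Im (F s)) + (fun s => complex.Im (G s)).
  by apply/funext => s; rewrite ImD.
by rewrite ImD; exact: is_deriveD.
Qed.

Lemma ReM (x y : R[i]) : complex.Re (x * y) =
  complex.Re x * complex.Re y - complex.Im x * complex.Im y.
Proof. by case: x; case: y. Qed.

Lemma ImM (x y : R[i]) : complex.Im (x * y) =
  complex.Re x * complex.Im y + complex.Im x * complex.Re y.
Proof. by case: x => a b; case: y => c d /=; rewrite [b * c]mulrC. Qed.

Lemma path_deriveM F G t l m : path_derive F t l -> path_derive G t m ->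
  path_derive (fun s => F s * G s) t (l * G t + F t * m).
Proof.
move=> [F1 F2] [G1 G2]; split.
  have -> : (fun s => complex.Re (F s * G s)) =
      (fun s => complex.Re (F s)) * (fun s => complex.Re (G s))
      - (fun s => complex.Im (F s)) * (fun s => complex.Im (G s)).
    by apply/funext => s; rewrite ReM.
  apply: (is_derive_eq (is_deriveB (is_deriveM F1 G1) (is_deriveM F2 G2))).
  by rewrite ReD !ReM /GRing.scale /=; ring.
have -> : (fun s => complex.Im (F s * G s)) =
    (fun s => complex.Re (F s)) * (fun s => complex.Im (G s))
    + (fun s => complex.Im (F s)) * (fun s => complex.Re (G s)).
  by apply/funext => s; rewrite ImM.
apply: (is_derive_eq (is_deriveD (is_deriveM F1 G2) (is_deriveM F2 G1))).
by rewrite ImD !ImM /GRing.scale /=; ring.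
Qed.

Lemma path_derive_ray h t : path_derive (fun s => s%:C * h) t h.
Proof.
have E : path_derive (fun s => s%:C) t 1.
  by split; [exact: (is_derive_id t 1) | exact: (is_derive_cst (0 : R) t 1)].
have := path_deriveM E (path_derive_cst h t).
by rewrite mul1r mulr0 addr0.
Qed.

(** Taylor polynomial of the exponential with [n] terms, hence of degree [n - 1]. *)
Definition exp_poly n h : R[i] := \sum_(k < n) h ^+ k / k`!%:R.

Lemma path_deriveX h t n :
  path_derive (fun s => (s%:C * h) ^+ n.+1) t (n.+1%:R * h * (t%:C * h) ^+ n).
Proof.
elim: n => [|n ih]; first by rewrite expr0 mulr1 mul1r; exact: path_derive_ray.
apply: (path_derive_eq _ _ (path_deriveM (path_derive_ray h t) ih)) => [s|].
  by rewrite [RHS]exprS.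
by rewrite [_ ^+ n.+1]exprS -[in RHS]addn1 natrD; ring.
Qed.

Lemma path_derive_exp_poly h t n :
  path_derive (fun s => exp_poly n.+1 (s%:C * h)) t (h * exp_poly n (t%:C * h)).
Proof.
elim: n => [|n ih].
  rewrite /exp_poly big_ord0 mulr0.
  have -> : (fun s : R => \sum_(k < 1) (s%:C * h) ^+ k / k`!%:R) = (fun=> 1).
    by apply/funext => s; rewrite big_ord1 expr0 mul1r invr1.
  exact: path_derive_cst.
apply: (path_derive_eq _ _
  (path_deriveD ih (path_deriveM (path_deriveX h t n) (path_derive_cst n.+1`!%:R^-1 t)))).
  by move=> s; rewrite /exp_poly [RHS]big_ord_recr.
rewrite /exp_poly big_ord_recr /= factS natrM.
have n0 : n.+1%:R != 0 :> R[i] by rewrite pnatr_eq0.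
have f0 : n`!%:R != 0 :> R[i] by rewrite pnatr_eq0 -lt0n fact_gt0.
move: (n.+1%:R : R[i]) (n`!%:R : R[i]) n0 f0 => u w u0 w0.
by field; rewrite u0 w0.
Qed.

Lemma cexpE (h : R[i]) : cexp h =
  Complex (expR (complex.Re h) * cos (complex.Im h)) (expR (complex.Re h) * sin (complex.Im h)).
Proof.
apply/eqP; rewrite /cexp eq_complex /=.
by rewrite !mul0r subr0 addr0 !eqxx.
Qed.

Lemma path_derive_cexp h t :
  path_derive (fun s => cexp (s%:C * h)) t (h * cexp (t%:C * h)).
Proof.
case: h => a b.
have dl (k : R) : is_derive t 1 (fun s : R => s * k) k.
  have -> : (fun s : R => s * k) = (fun s => s) * cst k by [].
  apply: is_derive_eq.
  by rewrite /GRing.scale /= mulr0 add0r mulr1.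
have dE : is_derive t 1 (fun s => expR (s * a)) (a * expR (t * a)).
  apply: is_derive_eq.
  by rewrite mulrC.
have dc : is_derive t 1 (fun s => cos (s * b)) (- (b * sin (t * b))).
  apply: is_derive_eq.
  by ring.
have ds : is_derive t 1 (fun s => sin (s * b)) (b * cos (t * b)).
  apply: is_derive_eq.
  by ring.
have e (s : R) : cexp (s%:C * Complex a b)
    = Complex (expR (s * a) * cos (s * b)) (expR (s * a) * sin (s * b)).
  by rewrite cexpE /= !mul0r subr0 addr0.
split.
  have -> : (fun s => complex.Re (cexp (s%:C * Complex a b))) =
      (fun s => expR (s * a)) * (fun s => cos (s * b)).
    by apply/funext => s; rewrite e.
  apply: is_derive_eq.
  by rewrite e /= /GRing.scale /=; ring.
have -> : (fun s => complex.Im (cexp (s%:C * Complex a b))) =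
    (fun s => expR (s * a)) * (fun s => sin (s * b)).
  by apply/funext => s; rewrite e.
apply: is_derive_eq.
by rewrite e /= /GRing.scale /=; ring.
Qed.

Lemma normc_ge_Re h : `|complex.Re h| <= normc h.
Proof.
case: h => a b /=; rewrite -sqrtr_sqr ler_sqrt ?addr_ge0 ?sqr_ge0 //.
by rewrite lerDl sqr_ge0.
Qed.

Lemma normc_ge_Im h : `|complex.Im h| <= normc h.
Proof.
case: h => a b /=; rewrite -sqrtr_sqr ler_sqrt ?addr_ge0 ?sqr_ge0 //.
by rewrite lerDr sqr_ge0.
Qed.

Lemma normc_le_ReIm h : normc h <= `|complex.Re h| + `|complex.Im h|.
Proof.
case: h => a b /=; rewrite -[leRHS]ger0_norm ?addr_ge0 // -sqrtr_sqr ler_sqrt ?sqr_ge0 //.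
rewrite sqrrD !real_normK ?num_real //.
by rewrite -addrA [X in _ <= _ + X]addrC addrA lerDl mulrn_wge0 // mulr_ge0.
Qed.

Lemma normcR t : normc t%:C = `|t|.
Proof. by rewrite /= expr0n /= addr0 sqrtr_sqr. Qed.

Lemma normc_ge0 h : 0 <= normc h.
Proof. by apply: le_trans (normc_ge_Re h). Qed.

(** The mean value theorem has no exact complex analogue; it is applied to the real and the
    imaginary part, and each contributes one [B]. *)
Lemma path_mvt F (dF : R -> R[i]) (B : R) :
  (forall t, path_derive F t (dF t)) ->
  (forall t, 0 <= t <= 1 -> normc (dF t) <= B) ->
  normc (F 1 - F 0) <= B + B.
Proof.
move=> h hB.
have gen (f df : R -> R) : (forall t, is_derive t 1 f (df t)) ->
    (forall t, 0 <= t <= 1 -> `|df t| <= B) -> `|f 1 - f 0| <= B.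
  move=> fd fB.
  have [|c c01 ->] := @MVT_segment R f df 0 1 ler01 (fun x _ => fd x).
    apply: derivable_within_continuous => x _; exact: (fd x).(ex_derive).
  by rewrite subr0 mulr1; apply: fB; rewrite -[0 <= c <= 1]/(c \in `[0, 1]).
apply: le_trans (normc_le_ReIm _) _; apply: lerD.
  rewrite raddfB /=; apply: (gen _ _ (fun t => (h t).1)) => t /hB.
  exact: le_trans (normc_ge_Re _).
rewrite raddfB /=; apply: (gen _ _ (fun t => (h t).2)) => t /hB.
exact: le_trans (normc_ge_Im _).
Qed.

Lemma cexp0 : cexp (0 : R[i]) = 1.
Proof. by rewrite cexpE /= expR0 cos0 sin0 mulr1 mulr0. Qed.

(** Along the ray [s * h], the remainder of order [n + 1] has derivative [h] times the remainder of
    order [n], so the mean value inequality raises the order by one and doubles the constant. For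
    [n = 0] the modulus of the exponential is [expR] of the real part, at most [expR 1] on the unit
    disc. *)
Lemma exp_poly_bound n : exists B : R, 0 <= B /\
  forall h, normc h <= 1 -> normc (cexp h - exp_poly n h) <= B * normc h ^+ n.
Proof.
elim: n => [|n [B [B0 hB]]].
  exists (expR 1); split=> [|h h1]; first exact: expR_ge0.
  rewrite /exp_poly big_ord0 subr0 expr0 mulr1 cexpE /= !exprMn -mulrDr cos2Dsin2 mulr1.
  rewrite sqrtr_sqr ger0_norm ?expR_ge0 // ler_expR.
  by apply: le_trans h1; apply: le_trans (ler_norm _) (normc_ge_Re h).
exists (B + B); split=> [|h h1]; first exact: addr_ge0.
have d t : path_derive (fun s => cexp (s%:C * h) - exp_poly n.+1 (s%:C * h)) t
    (h * (cexp (t%:C * h) - exp_poly n (t%:C * h))).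
  apply: (path_derive_eq _ _ (path_deriveD (path_derive_cexp h t)
    (path_deriveM (path_derive_cst (-1) t) (path_derive_exp_poly h t n)))) => [s|].
    by rewrite mulN1r.
  by ring.
have := @path_mvt _ _ (B * normc h ^+ n.+1) d.
rewrite mul1r mul0r cexp0.
have -> : exp_poly n.+1 (0 : R[i]) = 1.
  rewrite /exp_poly big_ord_recl expr0 mul1r invr1 big1 ?addr0 // => i _.
  by rewrite exprS !mul0r.
rewrite subrr subr0 -mulrDl; apply=> t /andP[t0 t1].
have nt : normc (t%:C * h) <= normc h.
  by rewrite normcM normcR ger0_norm // ler_piMl // normc_ge0.
rewrite normcM exprS mulrCA ler_wpM2l ?normc_ge0 //.
apply: le_trans (hB _ (le_trans nt h1)) _.
by rewrite ler_wpM2l // lerXn2r // nnegrE normc_ge0.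
Qed.

End ExpRemainder.

(** * From an expansion to a derivative *)

Section MoreJets.
Variable K : numFieldType.
Implicit Types (c a b : K) (f g : K -> K).

Lemma near_cderivable f g c :
  (\forall x \near c, f x = g x) -> cderivable f c -> cderivable g c.
Proof. by move=> fg [df]; split; exact: near_eq_derivable fg df. Qed.

Lemma cderivable_comp f g (x : K) :
  cderivable g x -> cderivable f (g x) -> cderivable (fun y => f (g y)) x.
Proof.
case=> /derivable1_diffP dg [/derivable1_diffP df]; split.
by apply/derivable1_diffP; exact: differentiable_comp.
Qed.

Lemma cderivable_affine (s k x : K) : cderivable (fun y => s * y + k) x.
Proof. exact: cderivableD (cderivableZ s (cderivable_id x)) (cderivable_cst k x). Qed.

(** Since an expansion says nothing at [c] itself, [f c = a] is what extends it to a full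
    neighbourhood, where [b] can be read off as the derivative. *)
Lemma jet_derive c f a b : jet c f a b -> f c = a -> is_derive c 1 f b.
Proof.
move=> [g dg fg] fc.
have := nbhs_singleton dg; case=> {}dg.
pose F : K -> K := (cst a + (cst b * (id - cst c)) + ((id - cst c) * (id - cst c) * g)).
have D : is_derive c 1 (id - cst c : K -> K) 1.
  have := is_deriveB (is_derive_id c (1 : K)) (is_derive_cst c c (1 : K)).
  by rewrite subr0.
have gD := derivableP dg.
have H := is_deriveD (is_deriveD (is_derive_cst a c (1 : K))
  (is_deriveM (is_derive_cst b c (1 : K)) D)) (is_deriveM (is_deriveM D D) gD).
have E : is_derive c 1 F b.
  have e1 : (id - cst c : K -> K) c = 0 by exact: (subrr c).
  have e2 : ((id - cst c) * (id - cst c) : K -> K) c = 0.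
    by transitivity ((id - cst c : K -> K) c * (id - cst c : K -> K) c); last rewrite e1 mul0r.
  by apply: (is_derive_eq H); rewrite e1 e2 /GRing.scale /=; ring.
apply: (near_eq_is_derive _ E).
move: fg; rewrite near_withinE; apply: filterS => x fx.
rewrite -[F x]/(a + b * (x - c) + (x - c) * (x - c) * g x).
have [->|xc] := eqVneq x c; first by rewrite fc subrr !mul0r mulr0 !addr0.
by rewrite fx // expr2.
Qed.

End MoreJets.

(** * Expansions of the exponential, of [zfun] and of its logarithmic derivatives *)

Section ComplexExp.
Variable R : realType.
Local Notation C := (Cplx R).
Implicit Types (x y c s k : C).

Lemma normCE x : `|x| = (normc x)%:C :> C.
Proof. by rewrite (@normc_def R x); case: x. Qed.

Lemma cexpD x y : cexp (x + y) = cexp x * cexp y.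
Proof.
case: x => a b; case: y => a' b'.
rewrite !cexpE /= expRD cosD sinD.
by apply/eqP; rewrite eq_complex /=; apply/andP; split; apply/eqP; ring.
Qed.

Lemma cexpN x : cexp (- x) = (cexp x)^-1.
Proof.
have h : cexp x * cexp (- x) = 1 by rewrite -cexpD subrr (cexp0 R).
have x0 : cexp x != 0 by apply/eqP => E; move/eqP: h; rewrite E mul0r eq_sym oner_eq0.
by apply: (mulfI x0); rewrite h mulfV.
Qed.

Lemma cexp_neq0 x : cexp x != 0.
Proof.
apply/eqP => E; have := cexpD x (- x).
by rewrite subrr (cexp0 R) E mul0r => /eqP; rewrite oner_eq0.
Qed.

(** The difference quotient differs from [l] by the error divided by [h], which is at most [B] times
    the modulus of [h]. *)
Lemma cderivable_quadratic (f : C -> C) c (l : C) (B : R) :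
  (forall h : C, normc h <= 1 -> normc (f (h + c) - f c - l * h) <= B * normc h ^+ 2) ->
  cderivable f c.
Proof.
move=> hB; split; apply/cvg_ex; exists l.
apply/cvgrPdist_le => e e0.
(* The norm is valued in the complex numbers; a positive element of them is a positive real. *)
have [r r0 er] : exists2 r : R, 0 < r & e = r%:C.
  exists (complex.Re e); first by move: e0; rewrite ltcE => /andP[].
  by rewrite RRe_real // gtr0_real.
(* Nothing is known about the sign of [B]; this replaces it by a positive constant that can be
   divided by. *)
have B1 : 0 < `|B| + 1 by rewrite ltr_pwDr.
have d0 : 0 < (r / (`|B| + 1))%:C :> C by rewrite ltcR divr_gt0.
have n0 : \forall h \near (0 : C)^', h != 0 by exact: nbhs_dnbhs_neq.
have n1 := @dnbhs0_le C C _ (@ltr01 C).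
have n2 := @dnbhs0_le C C _ d0.
move: n0 n1 n2; apply: filterS3 => h h0 h1 h2.
have {}h1 : normc h <= 1 by rewrite -lecR -normCE.
have {}h2 : normc h <= r / (`|B| + 1) by rewrite -lecR -normCE.
rewrite er normCE lecR.
have -> : l - h^-1 *: ((f \o shift c) (h *: (1 : C)) - f c)
   = - (h^-1 * (f (h + c) - f c - l * h)).
  transitivity (l - h^-1 * (f (h + c) - f c)); first by rewrite /GRing.scale /= mulr1.
  by field.
rewrite -mulN1r !normcM normcN normc1 mul1r normcV.
have nh : 0 < normc h.
  rewrite lt0r normc_ge0 andbT; apply/eqP => E; move/eqP: h0; apply.
  exact: eq0_normc.
rewrite mulrC ler_pdivrMr //; apply: le_trans (hB h h1) _.
rewrite expr2 mulrA ler_wpM2r ?(ltW nh) //.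
apply: (@le_trans _ _ ((`|B| + 1) * normc h)).
  by rewrite ler_wpM2r ?(ltW nh) // (le_trans (ler_norm B)) // lerDl.
by rewrite mulrC -ler_pdivlMr.
Qed.

(* The value at 0 is the one making the function entire. *)
Definition exp_tail n x : C :=
  if x == 0 then n`!%:R^-1 else (cexp x - exp_poly n x) / x ^+ n.

Lemma exp_polyS n (x : C) : exp_poly n.+1 x = exp_poly n x + x ^+ n / n`!%:R.
Proof. by rewrite /exp_poly big_ord_recr. Qed.

Lemma cexp_tail n x : cexp x = exp_poly n x + x ^+ n * exp_tail n x.
Proof.
rewrite /exp_tail; case: eqP => [->|/eqP x0]; last first.
  by rewrite mulrC divfK ?expf_neq0 // addrC subrK.
rewrite -exp_polyS /exp_poly big_ord_recl expr0 invr1 mul1r big1 ?addr0 ?(cexp0 R) // => i _.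
by rewrite exprS !mul0r.
Qed.

(** Two more Taylor terms than [n] leave, after division by [h ^+ n], a quadratic error around the
    value [1 / n!] and the slope [1 / (n + 1)!]. *)
Lemma cderivable_exp_tail0 n : cderivable (exp_tail n) 0.
Proof.
have [B [B0 hB]] := exp_poly_bound R n.+2.
apply: (@cderivable_quadratic _ _ (n.+1`!%:R^-1) B) => h h1.
rewrite addr0 {2}/exp_tail eqxx.
have [->|h0] := eqVneq h 0.
  by rewrite mulr0 subr0 /exp_tail eqxx subrr (normc0 R) expr2 !mulr0.
have hn : h ^+ n != 0 by rewrite expf_neq0.
have -> : exp_tail n h - n`!%:R^-1 - n.+1`!%:R^-1 * h = (cexp h - exp_poly n.+2 h) / h ^+ n.
  rewrite /exp_tail (negbTE h0) !exp_polyS [h ^+ n.+1]exprS.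
  move: (n`!%:R^-1 : C) (n.+1`!%:R^-1 : C) (h ^+ n) hn => p q w w0.
  by field.
have nh : 0 < normc h.
  by rewrite lt0r normc_ge0 andbT; apply/eqP => /eq0_normc; apply/eqP.
have nX m : normc (h ^+ m) = normc h ^+ m.
  by elim: m => [|m ih]; rewrite ?expr0 ?normc1 // !exprS normcM ih.
rewrite normcM normcV nX ler_pdivrMr ?exprn_gt0 // -mulrA -exprD add2n.
exact: hB.
Qed.

(** At 0 the first tail gives the expansion; the addition law carries it to every other point. *)
Lemma cderivable_cexp x : cderivable (@cexp R) x.
Proof.
have d0 : cderivable (@cexp R) 0.
  have -> : @cexp R = (fun x => 1 + x * exp_tail 1 x).
    apply/funext => y; rewrite (cexp_tail 1) expr1 /exp_poly big_ord1 expr0 mul1r invr1 //.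
  exact: cderivableD (cderivable_cst _ _) (cderivableM (cderivable_id _) (cderivable_exp_tail0 1)).
have -> : @cexp R = (fun y => cexp x * cexp (1 * y + - x)).
  by apply/funext => y; rewrite -cexpD mul1r addrC subrK.
apply: cderivableZ; apply: (cderivable_comp (cderivable_affine _ _ _)).
by rewrite mul1r subrr.
Qed.

Lemma cderivable_exp_poly n x : cderivable (fun y : C => exp_poly n y) x.
Proof.
elim: n => [|n ih].
  have -> : (fun y : C => exp_poly 0 y) = (fun=> 0).
    by apply/funext => y; rewrite /exp_poly big_ord0.
  exact: cderivable_cst.
have -> : (fun y : C => exp_poly n.+1 y) = (fun y => exp_poly n y + y ^+ n * n`!%:R^-1).
  by apply/funext => y; rewrite exp_polyS.
exact: cderivableD ih (cderivableM (cderivableX n (cderivable_id x)) (cderivable_cst _ x)).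
Qed.

Lemma cderivable_exp_tail n x : cderivable (exp_tail n) x.
Proof.
have [->|x0] := eqVneq x 0; first exact: cderivable_exp_tail0.
apply: (@near_cderivable _ (fun y => (cexp y - exp_poly n y) / y ^+ n)).
  have := near_neq0 (cderivable_id x) x0.
  by apply: filterS => y y0; rewrite /exp_tail (negbTE y0).
apply: cderivableM; first exact: cderivableB (cderivable_cexp x) (cderivable_exp_poly n x).
by apply: cderivableV; [rewrite expf_neq0 | exact: cderivableX (cderivable_id x)].
Qed.

Lemma cderivable_exp_tail_affine n (s k x : C) :
  cderivable (fun y => exp_tail n (s * y + k)) x.
Proof. exact: cderivable_comp (cderivable_affine s k x) (cderivable_exp_tail n _). Qed.

Lemma jet_cexp (u : C -> C) s k c : (forall x, u x = s * x + k) ->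
  jet c (fun x => cexp (u x)) (cexp (u c)) (s * cexp (u c)).
Proof.
move=> uE; exists (fun x => cexp (u c) * s ^+ 2 * exp_tail 2 (s * x + (- (s * c)))).
  by apply: filterE => x; apply: cderivableZ; exact: cderivable_exp_tail_affine.
apply: filterE => x.
have -> : u x = u c + s * (x - c) by rewrite !uE; ring.
rewrite cexpD [X in _ * X](cexp_tail 2) /exp_poly !big_ord_recr big_ord0 /=.
by rewrite -mulrBr add0r expr0 expr1 !invr1 !mulr1; ring.
Qed.

(* [(x - c) * z (s * (x - c))] is the inverse of [s * (1 - s (x - c) / 2 + ...)]. *)
Lemma jet_zfun_pole (u : C -> C) s c : s != 0 -> (forall x, u x = s * (x - c)) ->
  jet c (fun x => (x - c) * zfun (u x)) s^-1 (1 / 2).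
Proof.
move=> s0 uE.
(* [1 - cexp (- t)] with [t = s * (x - c)], divided by [t]. The division costs one order, hence the
   third tail for a second-order expansion. *)
pose F x := 1 + - s / 2 * (x - c) + (x - c) ^+ 2 * (s ^+ 2 * exp_tail 3 (- s * x + s * c)).
have jF : jet c F 1 (- s / 2).
  exists (fun x => s ^+ 2 * exp_tail 3 (- s * x + s * c)); last exact: filterE.
  by apply: filterE => x; apply: cderivableZ; exact: cderivable_exp_tail_affine.
have := jetZ s^-1 (jetV (oner_neq0 _) jF).
rewrite invr1 mulr1 expr1n divr1.
have -> : s^-1 * - (- s / 2) = 1 / 2 by field.
apply: jet_near; have : \forall x \near c^', x != c by exact: nbhs_dnbhs_neq.
apply: filterS => x; rewrite -subr_eq0 => xc.
have eF : 1 - cexp (- u x) = s * (x - c) * F x.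
  rewrite uE (cexp_tail 3) /exp_poly !big_ord_recr big_ord0 /= /F.
  have -> : - s * x + s * c = - (s * (x - c)) by ring.
  have -> : 2`!%:R = 2 :> C by [].
  by rewrite add0r expr0 expr1 !invr1 !mulr1; field.
by rewrite /zfun eF !invfM; move: ((F x)^-1) => q; field; rewrite xc s0.
Qed.

Lemma zfun_neq0 x : cexp x != 1 -> zfun x != 0.
Proof.
move=> x1; rewrite invr_eq0 subr_eq0 cexpN eq_sym -invr1.
by apply: contra x1 => /eqP /invr_inj ->.
Qed.

Lemma zfunN x : cexp x != 1 -> zfun (- x) = 1 - zfun x.
Proof.
move=> x1; rewrite /zfun opprK cexpN.
have e1 : 1 - cexp x != 0 by rewrite subr_eq0 eq_sym.
have e2 : cexp x - 1 != 0 by rewrite subr_eq0.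
by field; rewrite e1 e2 cexp_neq0.
Qed.

Lemma cexpN_neq1 x : (cexp (- x) != 1) = (cexp x != 1).
Proof. by rewrite cexpN -{1}invr1 (inj_eq invr_inj). Qed.

Lemma jet_zfun (u : C -> C) s k c : (forall x, u x = s * x + k) -> cexp (u c) != 1 ->
  jet c (fun x => zfun (u x)) (zfun (u c)) (s * (zfun (u c) * (1 - zfun (u c)))).
Proof.
move=> uE u1.
have uN x : - u x = - s * x + - k by rewrite uE; ring.
have e1 : 1 - cexp (- u c) != 0 by rewrite subr_eq0 eq_sym cexpN_neq1.
have := jetV e1 (jetB (jet_cst c 1) (jet_cexp c uN)).
rewrite sub0r -/(zfun (u c)).
suff -> : - - (- s * cexp (- u c)) / (1 - cexp (- u c)) ^+ 2
  = s * (zfun (u c) * (1 - zfun (u c))) by [].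
by rewrite /zfun; field.
Qed.

Lemma derive1_zfun x : cexp x != 1 -> derive1 (@zfun R) x = zfun x * (1 - zfun x).
Proof.
move=> x1; have := @jet_zfun (fun y => y) 1 0 x (fun y => _) x1.
rewrite mul1r => /(_ (fun y => _))/jet_derive-/(_ _ erefl) h.
by rewrite derive1E; apply: derive_val; apply: h => y; rewrite mul1r addr0.
Qed.

Lemma dlogzE x : cexp x != 1 -> dlogz x = 1 - zfun x.
Proof. by move=> x1; rewrite /dlogz derive1_zfun // mulrAC divff ?mul1r // zfun_neq0. Qed.

Lemma near_cexp_neq1 (u : C -> C) s k c : (forall x, u x = s * x + k) ->
  cexp (u c) != 1 -> \forall x \near c, cexp (u x) != 1.
Proof.
move=> uE u1.
have d : cderivable (fun x => cexp (u x) - 1) c.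
  have -> : u = (fun x => s * x + k) by apply/funext.
  apply: cderivableB (cderivable_cst _ _).
  exact: cderivable_comp (cderivable_affine s k c) (cderivable_cexp _).
have := near_neq0 d; rewrite subr_eq0 => /(_ u1).
by apply: filterS => x; rewrite subr_eq0.
Qed.

(** If the value at [c] is 1, then [cexp (u x) - 1] is [s * (x - c)] times a continuous function
    equal to 1 at [c], so the solutions of [cexp (u x) = 1] are isolated. *)
Lemma near_cexp_neq1_dnbhs (u : C -> C) s k c : s != 0 -> (forall x, u x = s * x + k) ->
  \forall x \near c^', cexp (u x) != 1.
Proof.
move=> s0 uE; have [u1|u1] := eqVneq (cexp (u c)) 1; last first.
  by apply: near_dnbhs; exact: near_cexp_neq1 uE u1.
have d : cderivable (fun x => exp_tail 1 (s * x + - (s * c))) c.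
  exact: cderivable_exp_tail_affine.
have t0 : exp_tail 1 (s * c + - (s * c)) != 0.
  by rewrite subrr /exp_tail eqxx invr1 oner_neq0.
have := near_dnbhs (near_neq0 d t0).
have : \forall x \near c^', x != c by exact: nbhs_dnbhs_neq.
apply: filterS2 => x; rewrite -subr_eq0 => xc tx.
have -> : u x = u c + (s * x + - (s * c)) by rewrite !uE; ring.
rewrite cexpD u1 mul1r (cexp_tail 1) /exp_poly big_ord1 expr0 invr1 mulr1 expr1.
have E : s * x + - (s * c) != 0 by rewrite -mulrBr mulf_neq0.
rewrite -subr_eq0 addrAC subrr add0r.
exact: mulf_neq0.
Qed.

Lemma jet_dlogz (u : C -> C) s k c : (forall x, u x = s * x + k) -> cexp (u c) != 1 ->
  jet c (fun x => dlogz (u x)) (1 - zfun (u c)) (- (s * (zfun (u c) * (1 - zfun (u c))))).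
Proof.
move=> uE u1; have := jetB (jet_cst c 1) (jet_zfun uE u1); rewrite sub0r.
apply: jet_near; apply: near_dnbhs.
by apply: filterS (near_cexp_neq1 uE u1) => x ux; rewrite dlogzE.
Qed.

Lemma derive1_dlogz x : cexp x != 1 ->
  derive1 (@dlogz R) x = - (zfun x * (1 - zfun x)).
Proof.
move=> x1; have idE (y : C) : y = 1 * y + 0 by rewrite mul1r addr0.
have := jet_dlogz idE x1; rewrite mul1r => /jet_derive-/(_ (dlogzE x1)) h.
by rewrite derive1E; apply: derive_val.
Qed.

Lemma jet_derive1_dlogz (u : C -> C) s k c : (forall x, u x = s * x + k) ->
  cexp (u c) != 1 ->
  exists b, jet c (fun x => derive1 (@dlogz R) (u x)) (derive1 (@dlogz R) (u c)) b.
Proof.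
move=> uE u1; rewrite derive1_dlogz //.
have j := jet_zfun uE u1; eexists.
apply: jet_near (jetN (jetM j (jetB (jet_cst c 1) j))); apply: near_dnbhs.
by apply: filterS (near_cexp_neq1 uE u1) => x ux; rewrite derive1_dlogz.
Qed.

Lemma jet_dlogz_pole (u : C -> C) s c : s != 0 -> (forall x, u x = s * (x - c)) ->
  jet c (fun x => (x - c) * dlogz (u x)) (- s^-1) (1 / 2).
Proof.
move=> s0 uE; have uE' x : u x = s * x + - (s * c) by rewrite uE; ring.
have := jetB (jet_eps c) (jet_zfun_pole s0 uE).
rewrite sub0r (_ : 1 - 1 / 2 = 1 / 2) ; last by field.
apply: jet_near; have := @near_cexp_neq1_dnbhs u s _ c s0 uE'.
by apply: filterS => x ux; rewrite dlogzE // mulrBr mulr1.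
Qed.

(** The function is [- (zfun u * zfun (- u))], a product of two simple poles with opposite slopes.
    Their first-order coefficients cancel, so the double pole carries no residue; [s ^+ 2 = 1]
    normalises its coefficient. *)
Lemma jet_derive1_dlogz_pole (u : C -> C) s c : s ^+ 2 = 1 -> (forall x, u x = s * (x - c)) ->
  jet c (fun x => (x - c) ^+ 2 * derive1 (@dlogz R) (u x)) 1 0.
Proof.
move=> s2 uE; have uE' x : u x = s * x + - (s * c) by rewrite uE; ring.
have s0 : s != 0 by apply/eqP => E; move/eqP: s2; rewrite E expr0n eq_sym oner_eq0.
have uN x : - u x = - s * (x - c) by rewrite uE; ring.
have sN : - s != 0 by rewrite oppr_eq0.
have := jetN (jetM (jet_zfun_pole s0 uE) (jet_zfun_pole sN uN)).
have -> : - (s^-1 * (- s)^-1) = 1 by rewrite invrN mulrN opprK -invfM -expr2 s2 invr1.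
have -> : - (s^-1 * (1 / 2) + 1 / 2 * (- s)^-1) = 0 by rewrite invrN; ring.
apply: jet_near; have := @near_cexp_neq1_dnbhs u s _ c s0 uE'.
by apply: filterS => x ux; rewrite derive1_dlogz // zfunN //; ring.
Qed.

End ComplexExp.

(** * Partitions into blocks of at most two elements *)

Section PairPartitions.
Variables (K : comRingType) (T : finType).
Implicit Types (A B D W : {set T}) (P : {set {set T}}) (F G : {set T} -> K).

Definition pair_partition B P :=
  finset.partition P B && [forall W in P, (#|W| <= 2)%N].

(** For [B := A :\: D] and [F := Hblock D v] this is, by conversion, the inner sum of [Jstar]. *)
Definition pair_sum B F : K := \sum_(P | pair_partition B P) \prod_(W in P) F W.

Lemma pair_partition_sub B P W : pair_partition B P -> W \in P ->
  [/\ W \subset B, W != finset.set0 & (#|W| <= 2)%N].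
Proof.
move=> /andP[pP /forall_inP h] WP; split; [exact: finset.partitionS pP WP | | exact: h].
exact: finset.partition_neq0 pP WP.
Qed.

Lemma eq_pair_sum B F G :
  (forall W, W \subset B -> W != finset.set0 -> (#|W| <= 2)%N -> F W = G W) ->
  pair_sum B F = pair_sum B G.
Proof.
move=> FG; apply: eq_bigr => P pP; apply: eq_bigr => W WP.
by have [? ? ?] := pair_partition_sub pP WP; exact: FG.
Qed.

(** Group the partitions by the block [W] that contains [a]; removing [W] is a bijection onto the
    partitions of [B :\: W]. *)
Lemma pair_sum_block B F a : a \in B -> pair_sum B F =
  \sum_(W : {set T} | [&& a \in W, W \subset B & (#|W| <= 2)%N])
     F W * pair_sum (B :\: W) F.
Proof.
move=> aB; rewrite /pair_sum (partition_big (fun P => finset.pblock P a)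
  (fun W => [&& a \in W, W \subset B & (#|W| <= 2)%N])) /=; last first.
  move=> P pP; have /andP[pt _] := pP.
  have aP : a \in finset.cover P by rewrite (finset.cover_partition pt).
  have [-> _ ->] := pair_partition_sub pP (finset.pblock_mem aP).
  by rewrite finset.mem_pblock aP.
apply: eq_bigr => W /and3P[aW WB W2]; rewrite big_distrr /=.
rewrite (reindex_onto (fun P => W |: P) (fun P => P :\ W)) /=; last first.
  move=> P /andP[/andP[pt _] /eqP <-]; rewrite finset.setD1K //.
  by apply: finset.pblock_mem; rewrite (finset.cover_partition pt).
have W0 : W != finset.set0 by apply/finset.set0Pn; exists a.
apply: eq_big => [P|P].
  apply/andP/idP => [[/andP[/andP[pt /forall_inP h2]] /eqP pb /eqP PW]|].
    have := finset.partitionD1 pt (finset.setU11 W P); rewrite PW => pt'.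
    by rewrite /pair_partition pt'; apply/forall_inP => V VP; rewrite h2 // inE VP orbT.
  move=> /andP[pt /forall_inP h2].
  have WP : W \notin P.
    apply/negP => /(finset.partitionS pt) /fintype.subsetP /(_ a aW).
    by rewrite inE aW.
  have pt' : finset.partition (W |: P) B.
    have := finset.partitionU1 pt W0; rewrite finset.setDE finset.setUIr finset.setUCr finset.setIT.
    rewrite (finset.setUidPr WB); apply.
    by rewrite -finset.setI_eq0 finset.setICA finset.setICr finset.setI0.
  split; last by rewrite finset.setU1K.
  apply/andP; split.
    rewrite /pair_partition pt' /=; apply/forall_inP => V.
    by rewrite finset.in_setU1 => /orP[/eqP ->|/h2].
  apply/eqP; apply: finset.def_pblock => //; last exact: finset.setU11.
  by case/and3P: pt'.
move=> /andP[/andP[/andP[pt _] _] /eqP PW].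
by rewrite big_setU1 //= -PW finset.setD11.
Qed.

Lemma pair_sum0 F : pair_sum finset.set0 F = 1.
Proof.
rewrite /pair_sum (big_pred1 finset.set0) => [|P].
  by apply: big1 => W; rewrite inE.
rewrite /pair_partition finset.partition_set0 /=; case: eqP => [->|] //=.
by apply/forall_inP => W; rewrite inE.
Qed.

(** The block of [a] is either [a] alone or [a] with one partner [b]. This recursion isolates the
    blocks that become singular. *)
Lemma pair_sum_rec B F a : a \in B -> pair_sum B F =
  F [set a]%SET * pair_sum (B :\ a) F +
  \sum_(b in B :\ a) F [set a; b]%SET * pair_sum (B :\ a :\ b) F.
Proof.
move=> aB; rewrite (pair_sum_block F aB).
rewrite (bigD1 [set a]%SET) /=; last by rewrite finset.set11 finset.sub1set aB finset.cards1.
congr (_ + _).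
(* The partner of [a] in [W]; the default [a] occurs only for the singleton block, already split
   off. *)
pose p W := odflt a [pick b in W :\ a].
have pE b : b != a -> p [set a; b]%SET = b.
  move=> ba; rewrite /p; case: pickP => [c|/(_ b)].
    by rewrite !inE => /andP[/negbTE ->] /= /eqP.
  by rewrite !inE ba eqxx orbT.
rewrite (reindex_onto (fun b => [set a; b]%SET) p) /=; last first.
  move=> W /andP[/and3P[aW WB W2] W1]; rewrite /p; case: pickP => [b|W0].
    rewrite !inE => /andP[ba bW] /=; apply/eqP; rewrite eqEcard finset.cards2 eq_sym ba W2 andbT.
    by apply/fintype.subsetP => x; rewrite !inE => /orP[]/eqP ->.
  case/eqP: W1; apply/finset.setP => x; rewrite inE.
  have := W0 x; rewrite !inE; case: eqP => [->|_] //=.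
apply: eq_big => [b|b].
  rewrite !inE eqxx /=; apply/idP/idP => [/andP[/andP[/andP[sB _] n1] /eqP pb]|/andP[ba bB]].
    have ba : b != a.
      by apply/eqP => E; case/eqP: n1; rewrite E finset.setUid.
    by rewrite ba (fintype.subsetP sB) // !inE eqxx orbT.
  rewrite pE // eqxx finset.cards2 ; case: (a == b); rewrite /= !andbT.
    apply/andP; split; first by apply/fintype.subsetP => x; rewrite !inE => /orP[]/eqP ->.
    by apply/eqP => /finset.setP /(_ b); rewrite !inE eqxx orbT (negbTE ba).
  apply/andP; split; first by apply/fintype.subsetP => x; rewrite !inE => /orP[]/eqP ->.
  by apply/eqP => /finset.setP /(_ b); rewrite !inE eqxx orbT (negbTE ba).
move=> _; congr (_ * pair_sum _ _).
by apply/finset.setP => x; rewrite !inE negb_or andbA [(x != b) && _]andbC.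
Qed.

End PairPartitions.

(** * Sums over subsets, split by membership of one element *)

Section SubsetSums.
Variables (T : finType) (V : nmodType).

Lemma sum_subset_setU1 (B : {set T}) (a : T) (f : {set T} -> V) : a \notin B ->
  \sum_(D : {set T} | D \subset a |: B) f D =
  \sum_(D : {set T} | D \subset B) (f D + f (a |: D)).
Proof.
move=> aB; rewrite (bigID (fun D : {set T} => a \in D)) /= addrC big_split /=.
congr (_ + _).
  apply: eq_bigl => D; apply/andP/idP => [[s aD]|s].
    apply/fintype.subsetP => x xD; have := fintype.subsetP s x xD; rewrite finset.in_setU1 => /orP[/eqP xa|//].
    by rewrite -xa xD in aD.
  split; first exact: fintype.subset_trans s (finset.subsetUr _ _).
  by apply: contra aB; exact: (fintype.subsetP s).
rewrite (reindex_onto (fun D => a |: D) (fun D => D :\ a)) /=; last first.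
  by move=> D /andP[_ aD]; rewrite finset.setD1K.
apply: eq_bigl => D; rewrite finset.setU11 andbT; apply/andP/idP => [[s /eqP DE]|s].
  apply/fintype.subsetP => x xD; have xa : x != a.
    by apply/eqP => E; move: xD; rewrite -DE E finset.setD11.
  by have := fintype.subsetP s x; rewrite !finset.in_setU1 xD orbT (negbTE xa) => /(_ isT).
have aD : a \notin D by apply: contra aB; exact: (fintype.subsetP s).
by rewrite finset.setU1K // eqxx; split=> //; exact: finset.setUS.
Qed.

End SubsetSums.

(** * The square root of the radicand *)

Section PairProd.
Variables (K : comRingType) (T : finType).
Implicit Types (D : {set T}) (q : T -> T -> K).

(* The order given by [enum_rank] selects each unordered pair once. *)
Definition pair_prod D q : K :=
  \prod_(a in D) \prod_(b in D) (if (enum_rank a < enum_rank b)%N then q a b else 1).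

(** Exchanging the indices in one of the two copies turns the pairs in increasing order into those
    in decreasing order; together they are all off-diagonal pairs. *)
Lemma pair_prod_sym_sq D q : (forall a b, q a b = q b a) ->
  pair_prod D q ^+ 2 = \prod_(a in D) \prod_(b in D) (if a == b then 1 else q a b).
Proof.
move=> qC; rewrite expr2 {2}/pair_prod exchange_big -big_split /=.
apply: eq_bigr => a _; rewrite -big_split /=; apply: eq_bigr => b _.
rewrite -(inj_eq enum_rank_inj) -(inj_eq val_inj) (qC b a) /=.
by case: ltngtP; rewrite ?mulr1 ?mul1r.
Qed.

Lemma pair_prod_setU1 D q t : (forall a b, q a b = q b a) -> t \notin D ->
  pair_prod (t |: D) q = pair_prod D q * \prod_(a in D) q t a.
Proof.
move=> qC tD; rewrite /pair_prod big_setU1 // big_setU1 //= ltnn mul1r.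
under [X in _ * X]eq_bigr do rewrite big_setU1 //.
rewrite big_split /= mulrA mulrC; congr (_ * _).
rewrite -big_split /=; apply: eq_bigr => a aD.
have : a != t by apply: contraNneq tD => <-.
rewrite -(inj_eq enum_rank_inj) -(inj_eq val_inj) (qC a t) /=.
by case: ltngtP; rewrite ?mulr1 ?mul1r.
Qed.

(** Writes a simple product as a double one, so that the factors [Yprod] of the radicand can be
    compared with the others pair by pair. *)
Lemma prod_diag D (f : T -> K) :
  \prod_(a in D) f a = \prod_(a in D) \prod_(b in D) (if a == b then f a else 1).
Proof.
apply: eq_bigr => a aD; rewrite (bigD1 a) //= eqxx big1 ?mulr1 // => b /andP[_].
by rewrite eq_sym => /negbTE ->.
Qed.

End PairProd.

Section Root.
Variables (R : realType) (T : finType).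
Local Notation C := (Cplx R).
Implicit Types (D : {set T}) (v : T -> C) (x : C).

(** The even function [w] of the overview. *)
Definition zsym x : C := zfun x * zfun (- x).

Definition zratio x y : C := zsym (x + y) / zsym (x - y).

Lemma zratioC x y : zratio x y = zratio y x.
Proof. by rewrite /zratio /zsym addrC !opprB opprD [_ (x - y) * _]mulrC. Qed.

Definition root_fun D v : C :=
  \prod_(a in D) zfun (- (2 * v a)) * pair_prod D (fun a b => zratio (v a) (v b)).

Lemma root_fun_setU1 D v t : t \notin D ->
  root_fun (t |: D) v = root_fun D v * (zfun (- (2 * v t)) * \prod_(a in D) zratio (v t) (v a)).
Proof.
move=> tD; have qC a b : zratio (v a) (v b) = zratio (v b) (v a) by exact: zratioC.
by rewrite /root_fun big_setU1 // (pair_prod_setU1 qC tD) /=; ring.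
Qed.

Lemma eq_root_fun D v v' : {in D, v =1 v'} -> root_fun D v = root_fun D v'.
Proof.
move=> vv; rewrite /root_fun; congr (_ * _); first by apply: eq_bigr => a aD; rewrite vv.
by apply: eq_bigr => a aD; apply: eq_bigr => b bD; rewrite !vv.
Qed.

Lemma root_fun_sq D v : generic D v -> root_fun D v ^+ 2 = radicand D v.
Proof.
move=> [g1 g2].
have zD a b : a \in D -> b \in D -> zfun (v a + v b) != 0.
  by move=> aD bD; apply: zfun_neq0; exact: g1.
have zB a b : a \in D -> b \in D -> a != b -> zfun (v a - v b) != 0.
  by move=> aD bD ab; apply: zfun_neq0; exact: g2.
rewrite /root_fun exprMn pair_prod_sym_sq; last by move=> a b; exact: zratioC.
rewrite -prodrXl (prod_diag D (fun a => zfun (- (2 * v a)) ^+ 2)) -big_split /=.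
(* For generic [v] the factors of zero argument are exactly the diagonal ones. *)
have Zd : Zdag D D (neg_val v) v =
    \prod_(a in D) \prod_(b in D) (if a == b then 1 else zfun (v b - v a)).
  apply: eq_bigr => a aD; rewrite big_mkcondr /=; apply: eq_bigr => b bD.
  rewrite /neg_val addrC subr_eq0; have [->|ab] := eqVneq a b; first by rewrite eqxx.
  case: eqP => //= E; have := g2 b a bD aD; rewrite eq_sym => /(_ ab).
  by rewrite E subrr (cexp0 R) eqxx.
(* The same product with its indices exchanged: one copy of each form makes the square of [Zdag] a
   product of [zsym (v a - v b)]. *)
have Zd' : Zdag D D (neg_val v) v =
    \prod_(a in D) \prod_(b in D) (if a == b then 1 else zfun (v a - v b)).
  by rewrite Zd exchange_big; apply: eq_bigr => a _; apply: eq_bigr => b _; rewrite eq_sym.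
rewrite /radicand expr2 {1}Zd Zd' /Yprod.
rewrite (prod_diag D (fun a => zfun (2 * neg_val v a))) (prod_diag D (fun a => zfun (2 * v a))).
rewrite /Zprod -!big_split /= -prodfV -big_split /=.
apply: eq_bigr => a aD; rewrite -!big_split /= -prodfV -big_split /=.
apply: eq_bigr => b bD; rewrite /neg_val.
have [<-|ab] := eqVneq a b.
  have -> : 2 * - v a = - (2 * v a) by ring.
  have -> : - v a - v a = - (2 * v a) by ring.
  have := zD a a aD aD; have -> : v a + v a = 2 * v a by ring.
  by move=> z0; field.
have ba : b != a by rewrite eq_sym.
rewrite /zratio /zsym -opprD opprB.
by field; rewrite !zB.
Qed.

Lemma cderivable_prod (I : Type) (s : seq I) (P : pred I) (f : I -> C -> C) x :
  (forall i, P i -> cderivable (f i) x) ->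
  cderivable (fun y => \prod_(i <- s | P i) f i y) x.
Proof.
move=> h; elim: s => [|i s ih].
  have -> : (fun y => \prod_(i <- [::] | P i) f i y) = (fun=> 1).
    by apply/funext => y; rewrite big_nil.
  exact: cderivable_cst.
case Pi : (P i).
  have -> : (fun y => \prod_(j <- i :: s | P j) f j y) =
      (fun y => f i y * \prod_(j <- s | P j) f j y).
    by apply/funext => y; rewrite big_cons Pi.
  exact: cderivableM (h _ Pi) ih.
have -> : (fun y => \prod_(j <- i :: s | P j) f j y) = (fun y => \prod_(j <- s | P j) f j y).
  by apply/funext => y; rewrite big_cons Pi.
exact: ih.
Qed.

Lemma cderivable_zfun (u : C -> C) x : cderivable u x -> cexp (u x) != 1 ->
  cderivable (fun y => zfun (u y)) x.
Proof.
move=> du u1; apply: (cderivable_comp du (f := @zfun R)).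
have uE (y : C) : y = 1 * y + 0 by rewrite mul1r addr0.
by have [d _] := jet_derive (jet_zfun uE u1) erefl.
Qed.

Lemma cderivable_upd v t a x : cderivable (fun y => [eta v with t |-> y] a) x.
Proof.
rewrite /=; case: eqP => _; [exact: cderivable_id | exact: cderivable_cst].
Qed.

Lemma upd_id v t : [eta v with t |-> v t] =1 v.
Proof. by move=> a /=; case: eqP => [->|]. Qed.

Lemma eq_generic D v v' : {in D, v =1 v'} -> generic D v -> generic D v'.
Proof.
move=> vv [g1 g2]; split=> a b aD bD; rewrite -!vv //; first exact: g1.
exact: g2.
Qed.

Lemma cderivable_root_fun D v t x : generic D [eta v with t |-> x] ->
  cderivable (fun y => root_fun D [eta v with t |-> y]) x.
Proof.
move=> [g1 g2].
have dN (u : C -> C) : cderivable u x -> cderivable (fun y => - u y) x.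
  move=> du; have := cderivableZ (-1) du.
  by apply: near_cderivable; apply: filterE => y; rewrite mulN1r.
apply: cderivableM.
  apply: cderivable_prod => a aD; apply: cderivable_zfun.
    by apply: dN; apply: cderivableZ; exact: cderivable_upd.
  rewrite cexpN_neq1 (_ : 2 * _ = [eta v with t |-> x] a + [eta v with t |-> x] a).
    exact: g1.
  by ring.
apply: cderivable_prod => a aD; apply: cderivable_prod => b bD.
case ab : (enum_rank a < enum_rank b)%N; last exact: cderivable_cst.
have ba : a != b by apply/eqP => E; move: ab; rewrite E ltnn.
have dD := cderivableD (cderivable_upd v t a x) (cderivable_upd v t b x).
have dB := cderivableB (cderivable_upd v t a x) (cderivable_upd v t b x).
have D1 := g1 a b aD bD; have B1 := g2 a b aD bD ba.
apply: cderivableM.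
  apply: cderivableM; first exact: (cderivable_zfun dD).
  by apply: (cderivable_zfun (dN _ dD)); rewrite cexpN_neq1.
apply: cderivableV.
  by apply: mulf_neq0; apply: zfun_neq0; rewrite // cexpN_neq1.
apply: cderivableM; first exact: (cderivable_zfun dB).
by apply: (cderivable_zfun (dN _ dB)); rewrite cexpN_neq1.
Qed.

Lemma cexpR (r : R) : cexp (r%:C : C) = (expR r)%:C.
Proof. by rewrite cexpE /= cos0 sin0 mulr0 mulr1. Qed.

Lemma zfunR (r : R) : zfun (r%:C : C) = ((1 - expR (- r))^-1)%:C.
Proof.
by rewrite /zfun -rmorphN cexpR fmorphV rmorphB.
Qed.

Lemma zsym_lt0 (r : R) : r != 0 -> zsym (r%:C : C) < 0.
Proof.
move=> r0; rewrite /zsym -rmorphN !zfunR -rmorphM opprK -(rmorph0 (real_complex R)) ltcR.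
case: (ltgtP r 0) r0 => // r0 _.
  rewrite nmulr_rlt0; first by rewrite invr_gt0 subr_gt0 -expR0 ltr_expR.
  by rewrite invr_lt0 subr_lt0 -expR0 ltr_expR oppr_gt0.
rewrite pmulr_rlt0; first by rewrite invr_lt0 subr_lt0 -expR0 ltr_expR.
by rewrite invr_gt0 subr_gt0 -expR0 ltr_expR oppr_lt0.
Qed.

Lemma lt0_realC x : x < 0 -> exists2 r : R, r < 0 & x = r%:C.
Proof.
move=> x0; exists (complex.Re x); last by rewrite RRe_real // ltr0_real.
by move: x0; rewrite ltcE => /andP[].
Qed.

Lemma root_fun_gt0 D v : generic D v -> (forall t, t \in D -> v t < 0) -> 0 < root_fun D v.
Proof.
move=> [g1 g2] neg; apply: mulr_gt0.
  apply: prodr_gt0 => a /neg /lt0_realC[r r0 ->].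
  have -> : - (2 * r%:C) = (- (2 * r))%:C :> C by rewrite rmorphN rmorphM rmorph_nat.
  rewrite zfunR opprK (ltcR 0) invr_gt0 subr_gt0 -expR0 ltr_expR.
  by rewrite pmulr_rlt0.
apply: prodr_gt0 => a aD; apply: prodr_gt0 => b bD; case: ifP => [ab|_]; last exact: ltr01.
have ba : a != b by apply/eqP => E; move: ab; rewrite E ltnn.
have B1 := g2 a b aD bD ba; move: B1.
have [r r0 ->] := lt0_realC (neg a aD); have [s s0 ->] := lt0_realC (neg b bD) => B1.
rewrite /zratio -rmorphD -rmorphB in B1 *.
rewrite -mulrNN -invrN divr_gt0 // oppr_gt0 zsym_lt0 //.
  by rewrite lt_eqF // -(addr0 0) ltrD.
by apply/eqP => E; move: B1; rewrite E (cexp0 R) eqxx.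
Qed.

Lemma sqrt_branch_root_fun D : sqrt_branch D (@root_fun D).
Proof.
split; [exact: root_fun_sq | | exact: root_fun_gt0].
move=> v t g _; have g' : generic D [eta v with t |-> v t].
  by apply: eq_generic g => a _; rewrite upd_id.
by case: (cderivable_root_fun g').
Qed.

End Root.

(** * Functions that are locally constant off isolated points *)

Section LocallyConstant.
Variable R : realType.
Local Notation C := (Cplx R).
Implicit Types (x y p u w : C) (f : C -> C) (t : R).

Definition locally_constant_at f x := \forall y \near x, f y = f x.

(** Balls of [Cplx R] have radii in [Cplx R]; this passes to real radii. *)
Lemma nbhs_normcP p (P : C -> Prop) :
  (\forall x \near p, P x) <->
  exists2 e : R, 0 < e & forall x, normc (x - p) < e -> P x.
Proof.
split=> [/nbhs_ballP[e /= e0 eP]|[e e0 eP]].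
  have [r r0 er] : exists2 r : R, 0 < r & e = r%:C.
    exists (complex.Re e); first by move: e0; rewrite ltcE => /andP[].
    by rewrite RRe_real // gtr0_real.
  exists r => // x xp; apply: eP; rewrite -ball_normE /ball_ /= er distrC normCE ltcR //.
apply/nbhs_ballP; exists (e%:C) => /=; first by rewrite (ltcR 0).
move=> x; rewrite -ball_normE /ball_ /= distrC normCE ltcR; exact: eP.
Qed.

Lemma near_ray u w t (P : C -> Prop) :
  (\forall x \near (u + t%:C * w), P x) -> \forall s \near t, P (u + s%:C * w).
Proof.
move=> /nbhs_normcP[e e0 eP]; apply/nbhs_ballP.
have w1 : 0 < normc w + 1 by rewrite ltr_pwDr // normc_ge0.
exists (e / (normc w + 1)) => /=; first exact: divr_gt0.
move=> s; rewrite -ball_normE /ball_ /= distrC => st; apply: eP.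
have -> : u + s%:C * w - (u + t%:C * w) = (s - t)%:C * w.
  by rewrite rmorphB; ring.
rewrite normcM normcR; move: st; rewrite ltr_pdivlMr //; apply: le_lt_trans.
by rewrite ler_wpM2l // lerDl.
Qed.

(** Along the segment the real and the imaginary part have derivative zero, so the mean value
    theorem applies to each; [re] below stands for either. *)
Lemma segment_constant f u w :
  (forall t, 0 <= t <= 1 -> locally_constant_at f (u + t%:C * (w - u))) -> f u = f w.
Proof.
move=> h.
have gen (re : R[i] -> R) : re (f (u + 1%:C * (w - u))) = re (f (u + 0%:C * (w - u))).
  pose g t : R := re (f (u + t%:C * (w - u))).
  have dg t : t \in `[0, 1] -> is_derive t 1 g 0.
    rewrite in_itv /= => /h /near_ray ht.
    apply: (near_eq_is_derive (f := cst (g t))).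
    by apply: filterS ht => s; rewrite /g => ->.
  have dg1 t : t \in `]0, 1[ -> is_derive t 1 g ((fun=> 0) t).
    by move=> t01; apply: dg; exact: subset_itv_oo_cc t01.
  have cg : {within `[0, 1], continuous g}.
    by apply: derivable_within_continuous => t /dg[].
  have [c _] := @MVT_segment R g (fun=> 0) 0 1 ler01 dg1 cg.
  by rewrite mul0r => /eqP; rewrite subr_eq0 => /eqP.
have : f (u + 1%:C * (w - u)) = f (u + 0%:C * (w - u)).
  by apply/eqP; rewrite eq_complex; apply/andP; split; apply/eqP; exact: gen.
by rewrite mul1r mul0r addr0 addrC subrK.
Qed.

(** Two points of a punctured disc are joined by their segment or, when it passes through the
    centre, by two segments with a common endpoint off that line. *)
Lemma punctured_constant f p :
  (\forall x \near p^', locally_constant_at f x) ->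
  exists k, \forall x \near p^', f x = k.
Proof.
rewrite near_withinE => /nbhs_normcP[e e0 eP].
have seg z w : z != p -> w != p -> normc (z - p) < e -> normc (w - p) < e ->
    (forall t, 0 <= t <= 1 -> z + t%:C * (w - z) != p) -> f z = f w.
  move=> zp wp ze we av; apply: segment_constant => t t01; apply: eP; last exact: av.
  have -> : z + t%:C * (w - z) - p = (1 - t)%:C * (z - p) + t%:C * (w - p).
    by rewrite rmorphB rmorph1; ring.
  case/andP: t01 => t0 t1.
  apply: le_lt_trans (le_normcD _ _) _; rewrite !normcM !normcR !ger0_norm ?subr_ge0 //.
  have [->|tn0] := eqVneq t 0; first by rewrite subr0 mul1r mul0r addr0.
  have tp : 0 < t by rewrite lt0r tn0.
  have -> : e = (1 - t) * e + t * e by ring.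
  by rewrite ler_ltD ?ler_wpM2l ?subr_ge0 ?ltr_pM2l // ltW.
have two z w : z != p -> w != p -> normc (z - p) < e -> normc (w - p) < e -> f z = f w.
  move=> zp wp ze we.
  have [[t /andP[t0 t1] tE]|av] := pselect (exists2 t, 0 <= t <= 1 & z + t%:C * (w - z) = p); last first.
    apply: seg => // t t01; apply/eqP => E; apply: av; by exists t.
  have Z0 : z - p != 0 by rewrite subr_eq0.
  have W0 : w - p != 0 by rewrite subr_eq0.
  have tn0 : t != 0.
    by apply: contra zp => /eqP E; move: tE; rewrite E mul0r addr0 => ->.
  have tC : t%:C != 0 :> C by rewrite (inj_eq (@complexI R) t 0).
  (* When [p] lies on the segment, [w - p] is a real multiple of [z - p]. *)
  have wE : w - p = ((t - 1) / t)%:C * (z - p).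
    rewrite rmorphM fmorphV rmorphB rmorph1; apply: (mulfI tC).
    have -> : t%:C * (w - p) = z + t%:C * (w - z) - p + (t%:C - 1) * (z - p) by ring.
    by rewrite tE subrr add0r; field.
  (* The segment from z to w meets p: go round through the point q. *)
  pose q : C := p + 'i * (z - p).
  have i0 : 'i != 0 :> C by rewrite eq_complex /= oner_eq0 andbF.
  have qp : q != p by rewrite -subr_eq0 addrC addKr mulf_neq0.
  have qe : normc (q - p) < e.
    by rewrite addrC addKr normcM /= expr0n expr1n add0r sqrtr1 mul1r.
  rewrite (seg z q) //; last first.
    move=> s _; rewrite -subr_eq0.
    have -> : z + s%:C * (q - z) - p = ((1 - s) +i* s) * (z - p).
      have -> : (1 - s) +i* s = 1 - s%:C + s%:C * 'i :> C.
        by apply/eqP; rewrite eq_complex /=; apply/andP; split; apply/eqP; ring.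
      by rewrite /q; ring.
    rewrite mulf_neq0 // eq_complex /= negb_and; have [->|] := eqVneq s 0; last by rewrite orbT.
    by rewrite subr0 oner_eq0.
  apply: seg => // s _; rewrite -subr_eq0.
  have -> : q + s%:C * (w - q) - p = ((s * ((t - 1) / t)) +i* (1 - s)) * (z - p).
    have -> : (s * ((t - 1) / t)) +i* (1 - s) = s%:C * ((t - 1) / t)%:C + (1 - s%:C) * 'i :> C.
      by apply/eqP; rewrite eq_complex /=; apply/andP; split; apply/eqP; ring.
    rewrite mulrDl -mulrA -wE /q; ring.
  (* The imaginary part vanishes only for [s = 1], and there the real part is nonzero because
     [w != p]. *)
  rewrite mulf_neq0 // eq_complex /= negb_and subr_eq0.
  have [<-|] := eqVneq 1 s; last by rewrite orbT.
  rewrite mul1r orbF; apply: contra W0 => /eqP E.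
  by rewrite wE E mul0r.
exists (f (p + (e / 2)%:C)); rewrite near_withinE; apply/nbhs_normcP; exists e => // x xe xp.
have e2 : 0 < e / 2 by rewrite divr_gt0.
apply: two => //.
  by rewrite -subr_eq0 addrC addKr (inj_eq (@complexI R) _ 0) gt_eqF.
by rewrite addrC addKr normcR gtr0_norm // ltr_pdivrMr // ltr_pMr // ltr1n.
Qed.

(** Let [k p] be the constant value of [f] on a punctured neighbourhood of [p]. This repaired
    function is locally constant everywhere, so it is constant on the segment from [x] to [y], and
    it agrees with [f] at both ends. *)
Lemma constant_off_isolated f x y :
  (forall p, \forall z \near p^', locally_constant_at f z) ->
  locally_constant_at f x -> locally_constant_at f y -> f x = f y.
Proof.
move=> h fx fy.
have /choice[k kP] : forall p, exists k, \forall z \near p^', f z = k.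
  by move=> p; exact: punctured_constant.
have kE z : locally_constant_at f z -> k z = f z.
  move=> /near_dnbhs fz.
  by have [q [<- <-]] := filter_ex (filterI (kP z) fz).
rewrite -(kE x fx) -(kE y fy); apply: segment_constant => t _.
move: (x + _) => p; have := kP p; rewrite near_withinE => /nbhs_interior.
apply: filterS => q qP; have [->//|qp] := eqVneq q p.
(* A point near [q] and different from both [p] and [q] lies in both punctured neighbourhoods, and
   so compares [k q] with [k p]. *)
have q' : \forall z \near q^', z != p.
  apply: near_dnbhs; have := near_neq0 (cderivable_shift p q); rewrite subr_eq0 => /(_ qp).
  by apply: filterS => z; rewrite subr_eq0.
have qq := near_dnbhs qP.
have [z [<- [zp zP]]] := filter_ex (filterI (kP q) (filterI q' qq)).
exact: zP.
Qed.

End LocallyConstant.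

(** * Uniqueness of the branch of the square root *)

Section Uniqueness.
Variables (R : realType) (T : finType).
Local Notation C := (Cplx R).
Implicit Types (D : {set T}) (v : T -> C) (x p : C) (t a b : T).

Lemma near_finite (I : finType) (F : set_system C) (FF : Filter F) (P : I -> C -> Prop) :
  (forall i, \forall x \near F, P i x) -> \forall x \near F, forall i, P i x.
Proof.
move=> h.
have : \forall x \near F, forall i, i \in enum I -> P i x.
  elim: (enum I) => [|i s ih]; first by apply: filterE => x i; rewrite in_nil.
  apply: filterS2 (h i) ih => x Pi Ps j; rewrite in_cons => /orP[/eqP->//|]; exact: Ps.
by apply: filterS => x Px i; apply: Px; rewrite mem_enum.
Qed.

(** Each condition involving [t] asks that an affine function of [x] of slope 2, 1 or -1 avoid the
    periods of [cexp]; there are finitely many conditions and each excludes isolated points only. *)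
Lemma near_generic D t v p : generic (D :\ t) v ->
  \forall x \near p^', generic D [eta v with t |-> x].
Proof.
move=> [g1 g2].
pose P (i : T * T) (x : C) := i.1 \in D -> i.2 \in D ->
  cexp ([eta v with t |-> x] i.1 + [eta v with t |-> x] i.2) != 1 /\
  (i.1 != i.2 -> cexp ([eta v with t |-> x] i.1 - [eta v with t |-> x] i.2) != 1).
suff : \forall x \near p^', forall i, P i x.
  by apply: filterS => x Px; split=> a b aD bD; have [h1 h2] := Px (a, b) aD bD.
apply: near_finite => -[a b]; rewrite /P /=.
have one0 : 1 != 0 :> C := oner_neq0 _.
have two0 : 2 != 0 :> C by rewrite pnatr_eq0.
have mone0 : -1 != 0 :> C by rewrite oppr_eq0.
case: (eqVneq a t) => [->|at0]; case: (eqVneq b t) => [->|bt0].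
- have := @near_cexp_neq1_dnbhs R (fun y => y + y) 2 0 p two0.
  have uE (y : C) : y + y = 2 * y + 0 by ring.
  by move=> /(_ uE); apply: filterS => y y1 _ _; split; rewrite ?eqxx.
- have n1 := @near_cexp_neq1_dnbhs R (fun y => y + v b) 1 (v b) p one0.
  have n2 := @near_cexp_neq1_dnbhs R (fun y => y - v b) 1 (- v b) p one0.
  have uE (y : C) : y + v b = 1 * y + v b by ring.
  have uE' (y : C) : y - v b = 1 * y + - v b by ring.
  by move: (n1 uE) (n2 uE'); apply: filterS2 => y.
- have n1 := @near_cexp_neq1_dnbhs R (fun y => v a + y) 1 (v a) p one0.
  have n2 := @near_cexp_neq1_dnbhs R (fun y => v a - y) (-1) (v a) p mone0.
  have uE (y : C) : v a + y = 1 * y + v a by ring.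
  have uE' (y : C) : v a - y = -1 * y + v a by ring.
  by move: (n1 uE) (n2 uE'); apply: filterS2 => y.
apply: filterE => y aD bD; split; first by apply: g1; rewrite !inE ?at0 ?bt0.
by move=> ab; apply: g2 => //; rewrite !inE ?at0 ?bt0.
Qed.

Lemma generic_sub D D' v : D' \subset D -> generic D v -> generic D' v.
Proof.
by move=> /fintype.subsetP s [g1 g2]; split=> a b /s aD /s bD; [exact: g1 | exact: g2].
Qed.

Lemma generic_upd D t v x : generic D [eta v with t |-> x] -> generic (D :\ t) v.
Proof.
move=> /(generic_sub (subsetDl D [set t]%SET)); apply: eq_generic => a.
by rewrite !inE /= => /andP[/negbTE ->].
Qed.

Lemma root_fun_neq0 D v : generic D v -> root_fun D v != 0.
Proof.
move=> [g1 g2]; apply: mulf_neq0.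
  apply/prodf_neq0 => a aD; apply: zfun_neq0; rewrite cexpN_neq1.
  have -> : 2 * v a = v a + v a by ring.
  exact: g1.
apply/prodf_neq0 => a aD; apply/prodf_neq0 => b bD; case: ifP => [ab|_]; last exact: oner_neq0.
have ba : a != b by apply/eqP => E; move: ab; rewrite E ltnn.
have D1 := g1 a b aD bD; have B1 := g2 a b aD bD ba.
apply: mulf_neq0; last rewrite invr_eq0.
  by apply: mulf_neq0; apply: zfun_neq0; rewrite // cexpN_neq1.
by apply: mulf_neq0; apply: zfun_neq0; rewrite // cexpN_neq1.
Qed.

(** At generic points the ratio is continuous with square 1, hence locally constant; the remaining
    values of the variable [t] are isolated. *)
Lemma branch_ratio D s v t x y : sqrt_branch D s -> t \in D ->
  generic D [eta v with t |-> x] -> generic D [eta v with t |-> y] ->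
  s [eta v with t |-> x] / root_fun D [eta v with t |-> x] =
  s [eta v with t |-> y] / root_fun D [eta v with t |-> y].
Proof.
move=> [s2 sd _] tD gx gy.
pose f z := s [eta v with t |-> z] / root_fun D [eta v with t |-> z].
have gt := generic_upd gx.
have f2 z : generic D [eta v with t |-> z] -> f z ^+ 2 = 1.
  move=> gz; rewrite expr_div_n s2 // root_fun_sq // divff //.
  by rewrite -root_fun_sq // expf_neq0 // root_fun_neq0.
have df z : generic D [eta v with t |-> z] -> cderivable f z.
  move=> gz; apply: cderivableM.
    split; have := sd _ t gz tD; rewrite /= eqxx.
    apply: near_eq_derivable; apply: filterE => w; congr (s _).
    by apply/funext => a /=; case: eqP.
  by apply: cderivableV; [exact: root_fun_neq0 | exact: cderivable_root_fun].
have lc z : generic D [eta v with t |-> z] -> locally_constant_at f z.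
  move=> gz; have dz := cderivableD (df z gz) (cderivable_cst (f z) z).
  have fz0 : f z != 0.
    by apply/eqP => E; have := f2 z gz; rewrite E expr0n => /eqP; rewrite eq_sym oner_eq0.
  (* Near [z] the value [f w] is [f z] or its opposite, and [f w + f z], nonzero at [w = z],
     excludes the opposite. *)
  have : f z + f z != 0 by rewrite -mulr2n mulrn_eq0.
  move=> /(near_neq0 dz) ; have := near_generic z gt; rewrite near_withinE.
  apply: filterS2 => w gw fw; have [->//|wz] := eqVneq w z.
  have := f2 w (gw wz); rewrite -(f2 z gz) => /eqP; rewrite -subr_eq0 subr_sqr.
  by rewrite mulf_eq0 (negbTE fw) orbF subr_eq0 => /eqP.
apply: (@constant_off_isolated _ f) => [p||]; [|exact: lc|exact: lc].
by apply: filterS (near_generic p gt) => z; exact: lc.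
Qed.

Lemma cexp_neq1_Re x : complex.Re x != 0 -> cexp x != 1.
Proof.
move=> x0; apply/eqP => E; have : normc (cexp x) = 1 by rewrite E (normc1 R).
rewrite cexpE /= !exprMn -mulrDr cos2Dsin2 mulr1 sqrtr_sqr ger0_norm ?expR_ge0 // => /eqP.
by rewrite -expR0 (inj_eq (@expR_inj R)) (negbTE x0).
Qed.

(* The variables are moved one at a time to negative reals, of modulus larger
   than all the real parts so that the valuation remains generic. *)
Lemma branch_eq_root_fun D s v : sqrt_branch D s -> generic D v -> s v = root_fun D v.
Proof.
(* Induction on the number of variables in [D] that are not yet negative reals. *)
move=> sb; have [n] := ubnP #|[set t in D | ~~ (v t < 0)]%SET|.
elim: n v => // n ih v cn gv.
have [E|[t]] := set_0Vmem [set t in D | ~~ (v t < 0)]%SET.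
  have neg t : t \in D -> v t < 0.
    move=> tD; apply: contraT => vt; have : t \in [set t in D | ~~ (v t < 0)]%SET.
      by rewrite inE tD vt.
    by rewrite E inE.
  (* All variables are negative reals: the two roots agree up to sign and both are positive. *)
  have [s2 _ s0] := sb.
  have := s2 v gv; rewrite -root_fun_sq // => /eqP; rewrite eqf_sqr => /orP[/eqP //|/eqP sE].
  have := s0 v gv neg; rewrite sE oppr_gt0 => /(lt_trans (root_fun_gt0 gv neg)).
  by rewrite ltxx.
rewrite inE => /andP[tD vt].
pose M : R := \sum_(b : T) `|complex.Re (v b)|.
pose y : C := (- (1 + M))%:C.
have M0 : 0 <= M by apply: sumr_ge0.
have leM b : `|complex.Re (v b)| <= M.
  by rewrite /M (bigD1 b) //= lerDl sumr_ge0.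
have y0 : y < 0 by rewrite (ltcR _ 0) oppr_lt0 ltr_pwDl.
have gy : generic D [eta v with t |-> y].
  have [g1 g2] := gv.
  have ReD' (z w : C) : complex.Re (z + w) = complex.Re z + complex.Re w by exact: ReD.
  have ReN' (z : C) : complex.Re (- z) = - complex.Re z by case: z.
  have bnd b : - M <= complex.Re (v b) <= M by rewrite -ler_norml.
  split=> a b aD bD; have /andP[ha ha'] := bnd a; have /andP[hb hb'] := bnd b.
    rewrite /=; case: (eqVneq a t) => _; case: (eqVneq b t) => _; last exact: g1.
    - by apply: cexp_neq1_Re; rewrite ReD' /=; apply/eqP; lra.
    - by apply: cexp_neq1_Re; rewrite ReD' /=; apply/eqP; lra.
    - by apply: cexp_neq1_Re; rewrite ReD' /=; apply/eqP; lra.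
  move=> ab; rewrite /=; case: (eqVneq a t) => [E|_]; case: (eqVneq b t) => [E'|_].
  - by rewrite E E' eqxx in ab.
  - by apply: cexp_neq1_Re; rewrite ReD' ReN' /=; apply/eqP; lra.
  - by apply: cexp_neq1_Re; rewrite ReD' ReN' /=; apply/eqP; lra.
  - exact: g2.
have vE : [eta v with t |-> v t] = v :> (T -> C) by apply/funext => a; exact: upd_id.
have gx : generic D [eta v with t |-> v t] by rewrite vE.
have cy : (#|[set b in D | ~~ (([eta v with t |-> y] : T -> C) b < 0)%R]%SET| < n)%N.
  rewrite ltnS in cn; apply: leq_trans cn; apply: proper_card; apply/properP; split.
    apply/fintype.subsetP => b; rewrite !inE /=; case: eqP => [_|//].
    by rewrite y0 andbF.
  by exists t; rewrite !inE /= ?tD ?vt // eqxx y0.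
have := branch_ratio sb tD gx gy; rewrite (ih _ cy gy) vE divff ?root_fun_neq0 //.
by move=> /(canRL (divfK (root_fun_neq0 gv))); rewrite mul1r.
Qed.

(** [root_fun] shows that some branch exists, so [xget] returns one; by uniqueness it agrees with
    [root_fun] at generic valuations. *)
Lemma sqrt_radicandE D v : generic D v -> sqrt_radicand D v = root_fun D v.
Proof.
move=> gv; apply: branch_eq_root_fun => //; rewrite /sqrt_radicand.
have h : [set s | sqrt_branch D s] (@root_fun R T D) by exact: sqrt_branch_root_fun.
exact: (xgetPex (fun=> 0) (ex_intro _ _ h)).
Qed.

End Uniqueness.

(** * Expansions of the summands *)

Section JetPairSum.
Variables (K : numFieldType) (T : finType).
Implicit Types (B : {set T}) (c : K).

Lemma setD1_comm B (a b : T) : B :\ a :\ b = B :\ b :\ a.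
Proof. by apply/setP => x; rewrite !inE andbCA. Qed.

(** The product rule when only singleton blocks vary: differentiating the block of [b] leaves a sum
    over the partitions of [B :\ b]. This is the situation when the moving variable belongs to
    [D]. *)
Lemma jet_pair_sum B c (F : K -> {set T} -> K) (F0 : {set T} -> K) (h : T -> K) :
  (forall b, b \in B -> jet c (fun x => F x [set b]%SET) (F0 [set b]%SET) (h b)) ->
  (forall x a b, a \in B -> b \in B -> a != b ->
     F x [set a; b]%SET = F0 [set a; b]%SET) ->
  jet c (fun x => pair_sum B (F x)) (pair_sum B F0)
    (\sum_(b in B) h b * pair_sum (B :\ b) F0).
Proof.
have [n] := ubnP #|B|; elim: n B => // n ih B Bn h1 h2.
have [->|[a aB]] := set_0Vmem B.
  rewrite pair_sum0 big_set0; apply: jet_ext (jet_cst c 1) => x.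
  by rewrite pair_sum0.
have sub1 b : {subset B :\ b <= B} by move=> y; rewrite inE => /andP[].
have card1 b : b \in B -> (#|B :\ b| < n)%N.
  by move=> bB; move: Bn; rewrite (cardsD1 b) bB.
have jB1 : jet c (fun x => pair_sum (B :\ a) (F x)) (pair_sum (B :\ a) F0)
    (\sum_(b in B :\ a) h b * pair_sum (B :\ a :\ b) F0).
  apply: ih => [|b /sub1|x b b' /sub1 ? /sub1]; [exact: card1|exact: h1|exact: h2].
have jB2 b : b \in B :\ a -> jet c (fun x => pair_sum (B :\ a :\ b) (F x))
    (pair_sum (B :\ a :\ b) F0)
    (\sum_(d in B :\ a :\ b) h d * pair_sum (B :\ a :\ b :\ d) F0).
  move=> bB; have sub2 : {subset B :\ a :\ b <= B}.
    by move=> y; rewrite inE => /andP[_] /sub1.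
  apply: ih => [|d /sub2|x d d' /sub2 ? /sub2]; [|exact: h1|exact: h2].
  by apply: leq_trans (card1 _ aB); rewrite ltnS subset_leq_card // finset.subsetDl.
have j := jetD (jetM (h1 a aB) jB1)
  (jet_sum _ (fun b (bB : b \in B :\ a) => jetZ (F0 [set a; b]%SET) (jB2 b bB))).
rewrite (pair_sum_rec F0 aB).
(* To match the recursion along [a], split off the term of [a], expand the other sums along [a], and
   exchange the two elements removed. *)
have -> : \sum_(b in B) h b * pair_sum (B :\ b) F0 =
    F0 [set a]%SET * (\sum_(b in B :\ a) h b * pair_sum (B :\ a :\ b) F0)
    + h a * pair_sum (B :\ a) F0
    + \sum_(b in B :\ a) F0 [set a; b]%SET *
        (\sum_(d in B :\ a :\ b) h d * pair_sum (B :\ a :\ b :\ d) F0).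
  rewrite (big_setD1 a aB) /= -addrA addrCA; congr (_ + _).
  under [X in _ = _ + X]eq_bigr do rewrite big_distrr /=.
  rewrite (exchange_big_dep (fun d => d \in B :\ a)) /=; last first.
    by move=> b d _; rewrite inE => /andP[].
  rewrite big_distrr -big_split /=; apply: eq_bigr => d dBa.
  have aBd : a \in B :\ d by move: dBa; rewrite !inE aB andbT eq_sym => /andP[].
  rewrite (pair_sum_rec F0 aBd) setD1_comm mulrDr mulrCA; congr (_ + _).
  rewrite big_distrr /=; apply: eq_big => [b|b _]; last by rewrite (setD1_comm _ d b) mulrCA.
  rewrite !inE in dBa *; case/andP: dBa => -> ->; rewrite !andbT.
  by rewrite (eq_sym d b) andbC -andbA.
apply: jet_ext (j (index_enum T)) => x; rewrite (pair_sum_rec (F x) aB); congr (_ + _).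
apply: eq_bigr => b; rewrite inE => /andP[]; rewrite inE => ba bB.
by rewrite h2 // eq_sym.
Qed.

End JetPairSum.

(** * The factors of a summand *)

Section Summands.
Variables (R : realType) (T : finType).
Local Notation C := (Cplx R).
Implicit Types (A B D : {set T}) (v : T -> C) (x y u c : C) (t a b : T).

(** [Hblock] on a singleton as a function of the value [u] of its element, so that it can be
    expanded in [u] and evaluated at both signs. *)
Definition hsum D v u : C :=
  \sum_(d in D) (dlogz (u - v d) - dlogz (u + v d)) + dlogz (2 * u).

(* Locked, because unification would otherwise unfold the derivative. *)
Definition ddlogz u : C := locked (derive1 (@dlogz R)) u.

Lemma HblockE D v (W : {set T}) : Hblock D v W =
  if #|W| == 1%N then \sum_(a in W) hsum D v (v a) else ddlogz (\sum_(a in W) v a).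
Proof. by rewrite /ddlogz -lock. Qed.

Lemma Hblock1 D v a : Hblock D v [set a]%SET = hsum D v (v a).
Proof. by rewrite HblockE cards1 eqxx big_set1. Qed.

Lemma Hblock2 D v a b : a != b -> Hblock D v [set a; b]%SET = ddlogz (v a + v b).
Proof. by move=> ab; rewrite HblockE cards2 ab /= big_setU1 ?inE //= big_set1. Qed.

Definition weight N D v : C :=
  cexp (- ((2 * N)%:R * \sum_(d in D) v d)) * (-1) ^+ #|D| * root_fun D v.

Definition block_sum D B v : C := pair_sum B (Hblock D v).

Lemma eq_hsum D v v' u : {in D, v =1 v'} -> hsum D v u = hsum D v' u.
Proof. by move=> vv; congr (_ + _); apply: eq_bigr => d dD; rewrite vv. Qed.

Lemma eq_block_sum D B v v' : {in D, v =1 v'} -> {in B, v =1 v'} -> block_sum D B v = block_sum D B v'.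
Proof.
move=> vD vB; apply: eq_pair_sum => W /fintype.subsetP WB _ _.
rewrite !HblockE; case: ifP => _.
  by apply: eq_bigr => a aW; rewrite (vB a (WB a aW)); exact: eq_hsum.
by congr (ddlogz _); apply: eq_bigr => a /WB /vB.
Qed.

Lemma eq_weight N D v v' : {in D, v =1 v'} -> weight N D v = weight N D v'.
Proof.
move=> vv; rewrite /weight (eq_root_fun vv); congr (cexp (- (_ * _)) * _ * _).
by apply: eq_bigr => d dD; rewrite vv.
Qed.

Lemma hsum_setU1 D v t u : t \notin D ->
  hsum (t |: D) v u = dlogz (u - v t) - dlogz (u + v t) + hsum D v u.
Proof. by move=> tD; rewrite /hsum big_setU1 //= -addrA. Qed.

Lemma weight_setU1 N D v t : t \notin D -> weight N (t |: D) v = - (weight N D v *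
  (cexp (- ((2 * N)%:R * v t)) * (zfun (- (2 * v t)) * \prod_(a in D) zratio (v t) (v a)))).
Proof.
move=> tD; rewrite /weight root_fun_setU1 // big_setU1 //= cardsU1 tD /= add1n exprS.
by rewrite mulrDr opprD cexpD; ring.
Qed.

Lemma block_sum_setU1 D B v t : t \notin B -> block_sum D (t |: B) v =
  hsum D v (v t) * block_sum D B v + \sum_(b in B) ddlogz (v t + v b) * block_sum D (B :\ b) v.
Proof.
move=> tB; rewrite /block_sum (pair_sum_rec _ (setU11 t B)) Hblock1 setU1K //; congr (_ + _).
apply: eq_bigr => b bB; rewrite Hblock2 //.
by apply: contraNneq tB => ->.
Qed.

Lemma Jstar_weight N A v : generic A v -> Jstar N A v =
  \sum_(D : {set T} | D \subset A) weight N D v * block_sum D (A :\: D) v.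
Proof.
move=> gA; apply: eq_bigr => D DA; rewrite sqrt_radicandE //.
exact: generic_sub DA gA.
Qed.

Lemma zsymN x : zsym (- x) = zsym x.
Proof. by rewrite /zsym opprK mulrC. Qed.

Lemma zsymE x : cexp x != 1 -> zsym x = zfun x * (1 - zfun x).
Proof. by move=> x1; rewrite /zsym zfunN. Qed.

Lemma zsym_neq0 x : cexp x != 1 -> zsym x != 0.
Proof. by move=> x1; rewrite mulf_neq0 // zfun_neq0 // cexpN_neq1. Qed.

Lemma ddlogzE x : cexp x != 1 -> ddlogz x = - zsym x.
Proof. by move=> x1; rewrite /ddlogz -lock derive1_dlogz // zsymE. Qed.

(** The logarithmic derivative of [zsym] is [1 - 2 * zfun]. *)
Lemma jet_zsym (u : C -> C) s k c : (forall x, u x = s * x + k) -> cexp (u c) != 1 ->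
  jet c (fun x => zsym (u x)) (zsym (u c)) (zsym (u c) * (s * (1 - 2 * zfun (u c)))).
Proof.
move=> uE u1; have uN x : - u x = - s * x + - k by rewrite uE; ring.
have uN1 : cexp (- u c) != 1 by rewrite cexpN_neq1.
have := jetM (jet_zfun uE u1) (jet_zfun uN uN1).
suff -> : zfun (u c) * (- s * (zfun (- u c) * (1 - zfun (- u c))))
   + s * (zfun (u c) * (1 - zfun (u c))) * zfun (- u c)
   = zsym (u c) * (s * (1 - 2 * zfun (u c))) by [].
by rewrite /zsym zfunN //; ring.
Qed.

Lemma jet_zratio c y : cexp (c + y) != 1 -> cexp (c - y) != 1 ->
  jet c (fun x => zratio x y) (zratio c y)
    (zratio c y * (2 * zfun (c - y) - 2 * zfun (c + y))).
Proof.
move=> h1 h2.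
have uE x : x + y = 1 * x + y by ring.
have uE' x : x - y = 1 * x + - y by ring.
have := jetM (jet_zsym uE h1) (jetV (zsym_neq0 h2) (jet_zsym uE' h2)).
suff -> : zsym (c + y) * (- (zsym (c - y) * (1 * (1 - 2 * zfun (c - y)))) / zsym (c - y) ^+ 2)
   + zsym (c + y) * (1 * (1 - 2 * zfun (c + y))) / zsym (c - y)
   = zratio c y * (2 * zfun (c - y) - 2 * zfun (c + y)) by [].
have := zsym_neq0 h2; rewrite /zratio => z0.
by field.
Qed.

(** As [zsym] is even, changing the sign of [x] exchanges numerator and denominator. Hence opposite
    variables in [D] cancel against every third one. *)
Lemma zratioNl x y : cexp (x + y) != 1 -> cexp (x - y) != 1 ->
  zratio (- x) y * zratio x y = 1.
Proof.
move=> h1 h2; have z1 := zsym_neq0 h1; have z2 := zsym_neq0 h2; rewrite /zratio.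
have -> : - x + y = - (x - y) by ring.
have -> : - x - y = - (x + y) by ring.
rewrite (zsymN (x - y)) (zsymN (x + y)).
by field; rewrite z1 z2.
Qed.

End Summands.

Section JetValues.
Variable K : numFieldType.
Implicit Types (c a b : K) (f g : K -> K).

(** For the cofactor of a simple pole only the value at [c] enters the residue, so the slope need
    not be named. *)
Definition jet0 c f a : Prop := exists b, jet c f a b.

Lemma jet0_cst c a : jet0 c (fun=> a) a.
Proof. by exists 0; exact: jet_cst. Qed.

Lemma jet0_ext c f g a : f =1 g -> jet0 c f a -> jet0 c g a.
Proof. by move=> fg [b jf]; exists b; exact: jet_ext jf. Qed.

Lemma jet0D c f g a b : jet0 c f a -> jet0 c g b -> jet0 c (fun x => f x + g x) (a + b).
Proof. by move=> [a' jf] [b' jg]; exists (a' + b'); exact: jetD. Qed.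

Lemma jet0B c f g a b : jet0 c f a -> jet0 c g b -> jet0 c (fun x => f x - g x) (a - b).
Proof. by move=> [a' jf] [b' jg]; exists (a' - b'); exact: jetB. Qed.

Lemma jet0N c f a : jet0 c f a -> jet0 c (fun x => - f x) (- a).
Proof. by move=> [a' jf]; exists (- a'); exact: jetN. Qed.

Lemma jet0M c f g a b : jet0 c f a -> jet0 c g b -> jet0 c (fun x => f x * g x) (a * b).
Proof. by move=> [a' jf] [b' jg]; eexists; exact: jetM jf jg. Qed.

Lemma jet0_sum (I : finType) (P : pred I) c (f : I -> K -> K) (a : I -> K) :
  (forall i, P i -> jet0 c (f i) (a i)) ->
  jet0 c (fun x => \sum_(i | P i) f i x) (\sum_(i | P i) a i).
Proof.
move=> h; have /choice[b hb] : forall i, exists b, P i -> jet c (f i) (a i) b.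
  move=> i; have [Pi|_] := boolP (P i); last by exists 0.
  by have [b jb] := h i Pi; exists b.
by exists (\sum_(i | P i) b i); exact: jet_sum.
Qed.

Lemma jet0_prod (I : finType) (P : pred I) c (f : I -> K -> K) (a : I -> K) :
  (forall i, P i -> jet0 c (f i) (a i)) ->
  jet0 c (fun x => \prod_(i | P i) f i x) (\prod_(i | P i) a i).
Proof.
move=> h; elim: (index_enum I) => [|i s ih].
  by rewrite big_nil; apply: jet0_ext (jet0_cst c 1) => x; rewrite big_nil.
rewrite big_cons; case: ifP => Pi; last first.
  by apply: jet0_ext ih => x; rewrite big_cons Pi.
by apply: jet0_ext (jet0M (h i Pi) ih) => x; rewrite big_cons Pi.
Qed.

Lemma jet_eps1 c f a : jet0 c f a -> jet c (fun x => (x - c) * f x) 0 a.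
Proof.
by move=> [b jf]; have := jetM (jet_eps c) jf; rewrite mul0r mul0r add0r mul1r.
Qed.

Lemma jet_eps2 c f a : jet0 c f a -> jet c (fun x => (x - c) ^+ 2 * f x) 0 0.
Proof.
move=> /jet_eps1 j; have := jetM (jet_eps c) j.
by rewrite !mul0r mulr0 addr0; apply: jet_ext => x; rewrite mulrA expr2.
Qed.

Lemma jet_log_mul c f g a b l m :
  jet c f a (a * l) -> jet c g b (b * m) ->
  jet c (fun x => f x * g x) (a * b) (a * b * (l + m)).
Proof.
move=> jf jg; have := jetM jf jg.
suff -> : a * (b * m) + a * l * b = a * b * (l + m) by [].
by ring.
Qed.

Lemma jet0_pair_sum (T : finType) (B : {set T}) c (F : K -> {set T} -> K) (F0 : {set T} -> K) :
  (forall b : T, b \in B -> jet0 c (fun x => F x [set b]%SET) (F0 [set b]%SET)) ->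
  (forall x (a b : T), a \in B -> b \in B -> a != b ->
     F x [set a; b]%SET = F0 [set a; b]%SET) ->
  jet0 c (fun x => pair_sum B (F x)) (pair_sum B F0).
Proof.
move=> h1 h2; have /choice[h hP] : forall b : T, exists l, b \in B ->
    jet c (fun x => F x [set b]%SET) (F0 [set b]%SET) l.
  move=> b; have [bB|_] := boolP (b \in B); last by exists 0.
  by have [l jl] := h1 b bB; exists l.
by eexists; exact: jet_pair_sum hP h2.
Qed.

End JetValues.

(** * Expansions at regular points, and the reflection identity for [hsum] *)

Section Summands.
Variables (R : realType) (T : finType).
Local Notation C := (Cplx R).
Implicit Types (A B D : {set T}) (v : T -> C) (x y u c : C) (t a b : T).

Lemma jet0_zfun (u : C -> C) s k c uc : (forall x, u x = s * x + k) -> u c = uc ->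
  cexp uc != 1 -> jet0 c (fun x => zfun (u x)) (zfun uc).
Proof. by move=> uE <- u1; eexists; exact: jet_zfun uE u1. Qed.

Lemma jet0_cexp (u : C -> C) s k c uc : (forall x, u x = s * x + k) -> u c = uc ->
  jet0 c (fun x => cexp (u x)) (cexp uc).
Proof. by move=> uE <-; eexists; exact: jet_cexp uE. Qed.

Lemma jet0_dlogz (u : C -> C) s k c uc : (forall x, u x = s * x + k) -> u c = uc ->
  cexp uc != 1 -> jet0 c (fun x => dlogz (u x)) (dlogz uc).
Proof. by move=> uE <- u1; rewrite (dlogzE u1); eexists; exact: jet_dlogz uE u1. Qed.

Lemma jet0_ddlogz (u : C -> C) s k c uc : (forall x, u x = s * x + k) -> u c = uc ->
  cexp uc != 1 -> jet0 c (fun x => ddlogz (u x)) (ddlogz uc).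
Proof.
move=> uE <- u1; rewrite /ddlogz -lock.
by have [b j] := jet_derive1_dlogz uE u1; exists b.
Qed.

Lemma jet_ddlogz_pole (u : C -> C) s c : s ^+ 2 = 1 -> (forall x, u x = s * (x - c)) ->
  jet c (fun x => (x - c) ^+ 2 * ddlogz (u x)) 1 0.
Proof. by move=> s2 uE; rewrite /ddlogz -lock; exact: jet_derive1_dlogz_pole s2 uE. Qed.

Lemma jet0_zratio c y : cexp (c + y) != 1 -> cexp (c - y) != 1 ->
  jet0 c (fun x => zratio x y) (zratio c y).
Proof. by move=> h1 h2; eexists; exact: jet_zratio h1 h2. Qed.

Lemma jet0_hsum D v (u : C -> C) s k c uc : (forall x, u x = s * x + k) -> u c = uc ->
  (forall d, d \in D -> cexp (uc - v d) != 1 /\ cexp (uc + v d) != 1) ->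
  cexp (2 * uc) != 1 -> jet0 c (fun x => hsum D v (u x)) (hsum D v uc).
Proof.
move=> uE ue reg reg2.
have e1 d x : u x - v d = s * x + (k - v d) by rewrite uE; ring.
have e2 d x : u x + v d = s * x + (k + v d) by rewrite uE; ring.
have e3 x : 2 * u x = 2 * s * x + 2 * k by rewrite uE; ring.
apply: jet0D; last by apply: (jet0_dlogz e3); rewrite // ue.
apply: jet0_sum => d dD; have [r1 r2] := reg d dD.
by apply: jet0B; [apply: (jet0_dlogz (e1 d)) | apply: (jet0_dlogz (e2 d))]; rewrite // ue.
Qed.

(** From [dlogz = 1 - zfun] and [zfun (- x) = 1 - zfun x]. The right side also arises from the
    logarithmic derivative of a weight containing two opposite variables, and this links the two. *)
Lemma hsumN D v u :
  (forall d, d \in D -> cexp (u - v d) != 1 /\ cexp (u + v d) != 1) ->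
  cexp (2 * u) != 1 ->
  hsum D v u + hsum D v (- u) =
  1 + \sum_(d in D) (2 * zfun (u + v d) - 2 * zfun (u - v d)).
Proof.
move=> reg reg2; have r2N : cexp (- (2 * u)) != 1 by rewrite cexpN_neq1.
have e2 : 2 * - u = - (2 * u) by ring.
rewrite /hsum addrACA -big_split /= [LHS]addrC e2 (dlogzE reg2) (dlogzE r2N).
rewrite (zfunN reg2); congr (_ + _); first by ring.
apply: eq_bigr => d dD; have [r1 r2] := reg d dD.
have rN1 : cexp (- (u - v d)) != 1 by rewrite cexpN_neq1.
have rN2 : cexp (- (u + v d)) != 1 by rewrite cexpN_neq1.
have -> : - u - v d = - (u + v d) by ring.
have -> : - u + v d = - (u - v d) by ring.
rewrite (dlogzE r1) (dlogzE r2) (dlogzE rN1) (dlogzE rN2) (zfunN r1) (zfunN r2).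
by ring.
Qed.

End Summands.

(* Otherwise a failing unification of two of these quantities unfolds them down
   to the arithmetic of the real and imaginary parts. *)
Opaque cexp zfun dlogz ddlogz zsym zratio root_fun hsum block_sum weight.

(** * Dependence of the factors on one variable *)

Section Updates.
Variables (R : realType) (T : finType).
Local Notation C := (Cplx R).
Implicit Types (A B D : {set T}) (v : T -> C) (x y u c : C) (t a b : T).

Lemma upd_off v t x D : t \notin D -> {in D, [eta v with t |-> x] =1 v}.
Proof. by move=> tD a aD /=; case: eqP => // E; rewrite -E aD in tD. Qed.

Lemma upd_at v t x : [eta v with t |-> x] t = x.
Proof. by rewrite /= eqxx. Qed.

Lemma block_sum_setU1_eq D B v v' t : t \notin B ->
  {in D, v' =1 v} -> {in B, v' =1 v} ->
  block_sum D (t |: B) v' =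
  hsum D v (v' t) * block_sum D B v + \sum_(b in B) ddlogz (v' t + v b) * block_sum D (B :\ b) v.
Proof.
move=> tB vD vB.
rewrite (block_sum_setU1 D _ tB) (eq_hsum _ vD) (eq_block_sum vD vB).
apply: (congr1 (fun z => hsum D v (v' t) * block_sum D B v + z)).
apply: eq_bigr => b bB; rewrite (vB b bB).
apply: (congr1 (fun z => ddlogz (v' t + v b) * z)).
by apply: (eq_block_sum vD) => a; rewrite inE => /andP[_]; exact: vB.
Qed.

Lemma block_sum_upd D B v t x : t \notin D -> t \notin B ->
  block_sum D (t |: B) [eta v with t |-> x] =
  hsum D v x * block_sum D B v + \sum_(b in B) ddlogz (x + v b) * block_sum D (B :\ b) v.
Proof.
move=> tD tB.
by rewrite (block_sum_setU1_eq tB (upd_off v x tD) (upd_off v x tB)) upd_at.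
Qed.

Lemma weight_setU1_eq N D v v' t : t \notin D -> {in D, v' =1 v} ->
  weight N (t |: D) v' = - (weight N D v *
  (cexp (- ((2 * N)%:R * v' t)) * (zfun (- (2 * v' t)) * \prod_(a in D) zratio (v' t) (v a)))).
Proof.
move=> tD vD; rewrite (weight_setU1 N _ tD) (eq_weight N vD).
have E : \prod_(a in D) zratio (v' t) (v' a) = \prod_(a in D) zratio (v' t) (v a).
  by apply: eq_bigr => a aD; rewrite (vD a aD).
by rewrite E.
Qed.

Lemma weight_upd N D v t x : t \notin D ->
  weight N (t |: D) [eta v with t |-> x] = - (weight N D v *
  (cexp (- ((2 * N)%:R * x)) * (zfun (- (2 * x)) * \prod_(a in D) zratio x (v a)))).
Proof. by move=> tD; rewrite (weight_setU1_eq N tD (upd_off v x tD)) upd_at. Qed.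

End Updates.

Lemma jet_eq (K : numFieldType) (c a b a' b' : K) (f : K -> K) :
  jet c f a b -> a = a' -> b = b' -> jet c f a' b'.
Proof. by move=> j <- <-. Qed.

(** * The four kinds of summand as [al] tends to [- be]; used with [B] the rest of [D] in the
    remaining variables *)

Section Terms.
Variables (R : realType) (T : finType).
Local Notation C := (Cplx R).
Variables (N : nat) (D B : {set T}) (al be : T) (v : T -> C) (b : C).
Hypotheses (alD : al \notin D) (alB : al \notin B) (beD : be \notin D)
  (beB : be \notin B) (ab : al != be) (vb : v be = b).
Hypothesis reg : forall a, a \in D :|: B ->
  cexp (b - v a) != 1 /\ cexp (b + v a) != 1.
Hypothesis reg2 : cexp (2 * b) != 1.

Lemma regular_opp (x y : C) : cexp x != 1 -> y = - x -> cexp y != 1.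
Proof. by move=> x1 ->; rewrite cexpN_neq1. Qed.

Lemma regular_D a : a \in D -> cexp (b - v a) != 1 /\ cexp (b + v a) != 1.
Proof. by move=> aD; apply: reg; rewrite finset.in_setU aD. Qed.

Lemma regular_B a : a \in B -> cexp (b - v a) != 1 /\ cexp (b + v a) != 1.
Proof. by move=> aB; apply: reg; rewrite finset.in_setU aB orbT. Qed.

Lemma regular_oppD a : a \in D -> cexp (- b - v a) != 1 /\ cexp (- b + v a) != 1.
Proof.
move=> /regular_D[h1 h2]; split; [apply: regular_opp h2 _ | apply: regular_opp h1 _]; ring.
Qed.

Lemma regular_oppB a : a \in B -> cexp (- b - v a) != 1 /\ cexp (- b + v a) != 1.
Proof.
move=> /regular_B[h1 h2]; split; [apply: regular_opp h2 _ | apply: regular_opp h1 _]; ring.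
Qed.

Lemma regular_opp_double : cexp (2 * - b) != 1.
Proof. by apply: regular_opp reg2 _; ring. Qed.

Lemma jet_pole_ddlogz : jet (- b) (fun x => (x - (- b)) ^+ 2 * ddlogz (x + b)) 1 0.
Proof. by apply: (jet_ddlogz_pole (expr1n _ 2)) => x; ring. Qed.

Lemma jet_pole_zsym : jet (- b) (fun x => (x - (- b)) ^+ 2 * zsym (x + b)) (- 1) 0.
Proof.
have := jetN jet_pole_ddlogz; rewrite oppr0; apply: jet_near.
have uE (x : C) : x + b = 1 * x + b by ring.
have := @near_cexp_neq1_dnbhs R _ 1 b (- b) (oner_neq0 _) uE.
by apply: filterS => x x1; rewrite (ddlogzE x1); ring.
Qed.

Lemma jet0_hsum_id : jet0 (- b) (fun x => hsum D v x) (hsum D v (- b)).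
Proof.
have uE (x : C) : x = 1 * x + 0 by ring.
exact: (jet0_hsum uE (erefl _) regular_oppD regular_opp_double).
Qed.

Lemma jet0_ddlogz_add y : y \in B ->
  jet0 (- b) (fun x => ddlogz (x + v y)) (ddlogz (- b + v y)).
Proof.
have uE (x : C) : x + v y = 1 * x + v y by ring.
by move=> /regular_oppB[_ h]; exact: (jet0_ddlogz uE (erefl _) h).
Qed.

Lemma jet0_ddlogz_sum (k : T -> C) :
  jet0 (- b) (fun x => \sum_(y in B) ddlogz (x + v y) * k y)
    (\sum_(y in B) ddlogz (- b + v y) * k y).
Proof. by apply: jet0_sum => y yB; exact: jet0M (jet0_ddlogz_add yB) (jet0_cst _ _). Qed.

(** Expanding along the block of [al], only its pairing with [be] is singular, through
    [ddlogz (x + b)], whose double pole has no residue; all other terms are regular and killed by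
    the square. *)
Lemma jet_term00 : jet (- b) (fun x => (x - (- b)) ^+ 2 *
    (weight N D [eta v with al |-> x] * block_sum D (al |: (be |: B)) [eta v with al |-> x]))
  (weight N D v * block_sum D B v) 0.
Proof.
have alBe : al \notin be |: B by rewrite finset.in_setU1 (negbTE ab).
pose f (x : C) := weight N D v * (
  (x - (- b)) ^+ 2 * (hsum D v x * block_sum D (be |: B) v
     + \sum_(y in B) ddlogz (x + v y) * block_sum D ((be |: B) :\ y) v)
  + (x - (- b)) ^+ 2 * ddlogz (x + b) * block_sum D B v).
apply: (@jet_ext _ _ f).
  move=> x; rewrite /f (eq_weight N (upd_off v x alD)) (block_sum_upd v x alD alBe).
  rewrite (big_setU1 _ beB) /= vb (setU1K beB).
  by ring.
have j1 : jet0 (- b) (fun x => hsum D v x * block_sum D (be |: B) v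
     + \sum_(y in B) ddlogz (x + v y) * block_sum D ((be |: B) :\ y) v)
   (hsum D v (- b) * block_sum D (be |: B) v
     + \sum_(y in B) ddlogz (- b + v y) * block_sum D ((be |: B) :\ y) v).
  exact: jet0D (jet0M jet0_hsum_id (jet0_cst _ _))
    (jet0_ddlogz_sum (fun y => block_sum D ((be |: B) :\ y) v)).
apply: (jet_eq (jetZ _ (jetD (jet_eps2 j1)
  (jetM jet_pole_ddlogz (jet_cst _ (block_sum D B v)))))).
  by rewrite add0r mul1r.
by rewrite mulr0 mul0r !addr0 mulr0.
Qed.

Lemma jet_pole_dlogz_add : jet (- b) (fun x => (x - (- b)) * dlogz (x + b)) (- 1) (1 / 2).
Proof.
have := @jet_dlogz_pole R (fun x => x + b) 1 (- b) (oner_neq0 _).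
by rewrite invr1; apply=> x; ring.
Qed.

(** The only pole is that of [- dlogz (x + b)] in the singleton block of [al]; its residue is 1. *)
Lemma jet_term01 : jet (- b) (fun x => (x - (- b)) ^+ 2 *
    (weight N (be |: D) [eta v with al |-> x] *
     block_sum (be |: D) (al |: B) [eta v with al |-> x]))
  0 (weight N (be |: D) v * block_sum (be |: D) B v).
Proof.
have alDe : al \notin be |: D by rewrite finset.in_setU1 (negbTE ab).
pose f (x : C) := weight N (be |: D) v * ((x - (- b)) ^+ 2 *
   ((dlogz (x - b) + hsum D v x) * block_sum (be |: D) B v
     + \sum_(y in B) ddlogz (x + v y) * block_sum (be |: D) (B :\ y) v)
   - (x - (- b)) * ((x - (- b)) * dlogz (x + b)) * block_sum (be |: D) B v).
apply: (@jet_ext _ _ f).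
  move=> x; rewrite /f (eq_weight N (upd_off v x alDe)) (block_sum_upd v x alDe alB).
  by rewrite (hsum_setU1 v x beD) vb; ring.
have uE (x : C) : x - b = 1 * x + - b by ring.
have r2 : cexp (- b - b) != 1 by apply: regular_opp reg2 _; ring.
have j0 : jet0 (- b) (fun x => dlogz (x - b) + hsum D v x) (dlogz (- b - b) + hsum D v (- b)).
  exact: jet0D (jet0_dlogz uE (erefl _) r2) jet0_hsum_id.
have j1 := jet0D (jet0M j0 (jet0_cst (- b) (block_sum (be |: D) B v)))
  (jet0_ddlogz_sum (fun y => block_sum (be |: D) (B :\ y) v)).
apply: (jet_eq (jetZ _ (jetB (jet_eps2 j1)
  (jetM (jetM (jet_eps _) jet_pole_dlogz_add) (jet_cst _ (block_sum (be |: D) B v)))))).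
  by ring.
by ring.
Qed.

Let v' : T -> C := [eta v with be |-> - b].

(** In the limit, [al] in [D] with value [- b] acts as [be] in [D] after the sign change [v']. *)
Lemma jet0_block_sum_add (B' : {set T}) : {subset B' <= B} ->
  jet0 (- b) (fun x => block_sum (al |: D) B' [eta v with al |-> x])
    (block_sum (be |: D) B' v').
Proof.
Transparent block_sum.
move=> sB; apply: jet0_pair_sum => [y /sB yB|x y z /sB yB /sB zB yz]; last first.
  rewrite !Hblock2 // (upd_off v x alB yB) (upd_off v x alB zB).
  by rewrite /v' (upd_off v (- b) beB yB) (upd_off v (- b) beB zB).
Opaque block_sum.
have [r1 r2] := regular_B yB.
pose f (x : C) := dlogz (v y - x) - dlogz (v y + x) + hsum D v (v y).
apply: (@jet0_ext _ _ f).
  move=> x; rewrite /f Hblock1 (hsum_setU1 _ _ alD) upd_at (upd_off v x alB yB).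
  by rewrite (eq_hsum _ (upd_off v x alD)).
rewrite Hblock1 (hsum_setU1 _ _ beD) /v' upd_at (upd_off v (- b) beB yB).
rewrite (eq_hsum _ (upd_off v (- b) beD)).
have uE (x : C) : v y - x = -1 * x + v y by ring.
have uE' (x : C) : v y + x = 1 * x + v y by ring.
have g1 : cexp (v y - - b) != 1.
  by have -> : v y - - b = b + v y by ring.
have g2 : cexp (v y + - b) != 1 by apply: regular_opp r1 _; ring.
exact: jet0D (jet0B (jet0_dlogz uE (erefl _) g1) (jet0_dlogz uE' (erefl _) g2))
  (jet0_cst _ _).
Qed.

Lemma jet0_weight_add :
  jet0 (- b) (fun x => weight N (al |: D) [eta v with al |-> x]) (weight N (be |: D) v').
Proof.
pose f (x : C) := - (weight N D v * (cexp (- ((2 * N)%:R * x)) *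
  (zfun (- (2 * x)) * \prod_(a in D) zratio x (v a)))).
apply: (@jet0_ext _ _ f) => [x|]; first by rewrite /f weight_upd.
rewrite /v' (weight_upd N v (- b) beD).
have uE (x : C) : - ((2 * N)%:R * x) = - (2 * N)%:R * x + 0 by ring.
have uE' (x : C) : - (2 * x) = -2 * x + 0 by ring.
have r2 : cexp (- (2 * - b)) != 1 by rewrite cexpN_neq1; exact: regular_opp_double.
apply: jet0N; apply: (jet0M (jet0_cst _ _)).
apply: (jet0M (jet0_cexp uE (erefl _))).
apply: (jet0M (jet0_zfun uE' (erefl _) r2)).
by apply: jet0_prod => a /regular_oppD[h1 h2]; exact: jet0_zratio.
Qed.

(** Now the pole sits in the singleton block of [be], while the weight and the remaining blocks also
    vary; as the pole is simple, only their limits, expressed with [v'], matter. *)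
Lemma jet_term10 : jet (- b) (fun x => (x - (- b)) ^+ 2 *
    (weight N (al |: D) [eta v with al |-> x] *
     block_sum (al |: D) (be |: B) [eta v with al |-> x]))
  0 (weight N (be |: D) v' * block_sum (be |: D) B v').
Proof.
pose W x := weight N (al |: D) [eta v with al |-> x].
pose M (B' : {set T}) x := block_sum (al |: D) B' [eta v with al |-> x].
pose f (x : C) := W x * ((x - (- b)) ^+ 2 *
   ((dlogz (b - x) + hsum D v b) * M B x + \sum_(y in B) ddlogz (b + v y) * M (B :\ y) x)
   - (x - (- b)) * ((x - (- b)) * dlogz (x + b)) * M B x).
have beNal : be \notin [set al]%SET by rewrite inE eq_sym.
apply: (@jet_ext _ _ f).
  move=> x; rewrite /f /W /M (block_sum_setU1 _ _ beB) (upd_off v x _ (set11 be)) ?vb; last first.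
    by rewrite inE.
  rewrite (hsum_setU1 _ _ alD) upd_at (eq_hsum _ (upd_off v x alD)) (addrC b x).
  have -> : \sum_(y in B) ddlogz (b + [eta v with al |-> x] y) *
      block_sum (al |: D) (B :\ y) [eta v with al |-> x] =
    \sum_(y in B) ddlogz (b + v y) * block_sum (al |: D) (B :\ y) [eta v with al |-> x].
    by apply: eq_bigr => y yB; rewrite (upd_off v x alB yB).
  by ring.
have r2 : cexp (b - - b) != 1 by have -> : b - - b = 2 * b by ring.
have uE (x : C) : b - x = -1 * x + b by ring.
have jM (B' : {set T}) := @jet0_block_sum_add B'.
have jB := jM B (fun y yB => yB).
have jS : jet0 (- b) (fun x => \sum_(y in B) ddlogz (b + v y) * M (B :\ y) x)
    (\sum_(y in B) ddlogz (b + v y) * block_sum (be |: D) (B :\ y) v').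
  apply: jet0_sum => y yB; apply: (jet0M (jet0_cst _ _)).
  by apply: jM => z; rewrite inE => /andP[].
have j1 := jet0D (jet0M (jet0D (jet0_dlogz uE (erefl _) r2) (jet0_cst _ (hsum D v b))) jB) jS.
have [w' jW] := jet0_weight_add; have [m' jB'] := jB.
apply: (jet_eq (jetM jW (jetB (jet_eps2 j1)
  (jetM (jetM (jet_eps _) jet_pole_dlogz_add) jB')))).
  by ring.
by ring.
Qed.

(** The contributions of [al] and [be] to a singleton block [y] cancel at [x = - b]; their slopes
    there add up and give the two [ddlogz] terms. *)
Lemma jet_block_sum_both :
  jet (- b) (fun x => block_sum (al |: (be |: D)) B [eta v with al |-> x])
    (block_sum D B v)
    (\sum_(y in B) - (ddlogz (b + v y) + ddlogz (- b + v y)) * block_sum D (B :\ y) v).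
Proof.
Transparent block_sum.
apply: jet_pair_sum => [y yB|x y z yB zB yz]; last first.
  by rewrite !Hblock2 // (upd_off v x alB yB) (upd_off v x alB zB).
Opaque block_sum.
have alDe : al \notin be |: D by rewrite finset.in_setU1 (negbTE ab).
have [r1 r2] := regular_B yB; have [n1 n2] := regular_oppB yB.
pose f (x : C) := dlogz (v y - x) - dlogz (v y + x)
  + (dlogz (v y - b) - dlogz (v y + b) + hsum D v (v y)).
apply: (@jet_ext _ _ f).
  move=> x; rewrite /f Hblock1 (hsum_setU1 _ _ alDe) upd_at (upd_off v x alB yB).
  by rewrite (eq_hsum _ (upd_off v x alDe)) (hsum_setU1 _ _ beD) vb.
have uE (x : C) : v y - x = -1 * x + v y by ring.
have uE' (x : C) : v y + x = 1 * x + v y by ring.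
have e1 : v y - - b = b + v y by ring.
have e2 : v y + - b = - b + v y by ring.
have e4 : v y + b = b + v y by ring.
have g1 : cexp (v y - - b) != 1 by rewrite e1.
have g2 : cexp (v y + - b) != 1 by rewrite e2.
have j := jetD (jetB (jet_dlogz uE g1) (jet_dlogz uE' g2))
  (jet_cst (- b) (dlogz (v y - b) - dlogz (v y + b) + hsum D v (v y))).
apply: (jet_eq j).
  by rewrite Hblock1 e1 e2 e4 (dlogzE n2) (dlogzE r2); ring.
by rewrite e1 e2 (ddlogzE r2) (ddlogzE n2) (zsymE r2) (zsymE n2); ring.
Qed.

(* The logarithmic derivative at [- b] of the weight deprived of its double pole. *)
Definition pole_rate : C :=
  - (2 * N)%:R - 1 + \sum_(a in D) (2 * zfun (- b - v a) - 2 * zfun (- b + v a)).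

(** The double pole is that of [zsym (x + b)], with coefficient -1 and no residue; the cofactor [G]
    has value 1 and logarithmic derivative [pole_rate] at [- b]. *)
Lemma jet_weight_both :
  jet (- b) (fun x => (x - (- b)) ^+ 2 * weight N (al |: (be |: D)) [eta v with al |-> x])
    (- weight N D v) (- weight N D v * pole_rate).
Proof.
have alDe : al \notin be |: D by rewrite finset.in_setU1 (negbTE ab).
have nbb : cexp (- b - b) != 1 by apply: regular_opp reg2 _; ring.
have zbb := zsym_neq0 nbb.
pose E (x : C) := cexp (- ((2 * N)%:R * x)).
pose G (x : C) := E x * E b * (zfun (- (2 * x)) * zfun (- (2 * b)) * ((zsym (x - b))^-1 *
   \prod_(a in D) (zratio x (v a) * zratio b (v a)))).
pose f (x : C) := weight N D v * ((x - (- b)) ^+ 2 * zsym (x + b) * G x).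
apply: (@jet_ext _ _ f).
  move=> x; rewrite /f /G /E (weight_upd N v x alDe) (weight_setU1 N v beD) vb.
  rewrite (big_setU1 _ beD) /= vb big_split /=.
  have -> : zratio x b = zsym (x + b) / zsym (x - b) by [].
  by ring.
have cE (x : C) : - ((2 * N)%:R * x) = - (2 * N)%:R * x + 0 by ring.
have zE (x : C) : - (2 * x) = -2 * x + 0 by ring.
have qE (x : C) : x - b = 1 * x + - b by ring.
have rz : cexp (- (2 * - b)) != 1 by rewrite cexpN_neq1; exact: regular_opp_double.
have logify (g : C -> C) (p q l : C) : jet (- b) g p q -> q = p * l -> jet (- b) g p (p * l).
  by move=> j <-.
have jE : jet (- b) (fun x => E x * E b) (E (- b) * E b) (E (- b) * E b * - (2 * N)%:R).
  by apply: (jet_eq (jetM (jet_cexp (- b) cE) (jet_cst _ (E b)))) => //; rewrite /E; ring.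
have jZ : jet (- b) (fun x => zfun (- (2 * x)) * zfun (- (2 * b)))
    (zfun (- (2 * - b)) * zfun (- (2 * b)))
    (zfun (- (2 * - b)) * zfun (- (2 * b)) * (-2 * (1 - zfun (- (2 * - b))))).
  by apply: (jet_eq (jetM (jet_zfun zE rz) (jet_cst _ (zfun (- (2 * b)))))) => //; ring.
have jV : jet (- b) (fun x => (zsym (x - b))^-1) (zsym (- b - b))^-1
    ((zsym (- b - b))^-1 * - (1 - 2 * zfun (- b - b))).
  apply: (jet_eq (jetV zbb (jet_zsym qE nbb))) => //.
  by move: (zsym _) zbb => w w0; field.
have jP : jet (- b) (fun x => \prod_(a in D) (zratio x (v a) * zratio b (v a)))
    (\prod_(a in D) (zratio (- b) (v a) * zratio b (v a)))
    (\prod_(a in D) (zratio (- b) (v a) * zratio b (v a)) *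
     \sum_(a in D) (2 * zfun (- b - v a) - 2 * zfun (- b + v a))).
  apply: jet_prod => a /regular_oppD[h1 h2].
  by apply: (jet_eq (jetM (jet_zratio h2 h1) (jet_cst _ (zratio b (v a))))) => //; ring.
have jG := jet_log_mul jE (jet_log_mul jZ (jet_log_mul jV jP)).
(* The value of [G] at [- b]: exponentials, [zratio] factors and values of [zfun] at opposite
   arguments cancel in turn. *)
have P1 : \prod_(a in D) (zratio (- b) (v a) * zratio b (v a)) = 1.
  by rewrite big1 // => a /regular_D[h1 h2]; rewrite zratioNl.
have E1 : E (- b) * E b = 1.
  rewrite /E -cexpD; have -> : - ((2 * N)%:R * - b) + - ((2 * N)%:R * b) = 0 by ring.
  exact: cexp0.
have e2 : - (2 * - b) = 2 * b by ring.
have e3 : - b - b = - (2 * b) by ring.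
have Z1 : zfun (- (2 * - b)) * zfun (- (2 * b)) * (zsym (- b - b))^-1 = 1.
  by rewrite e2 e3 zsymN divff //; exact: zsym_neq0.
have V1 : E (- b) * E b * (zfun (- (2 * - b)) * zfun (- (2 * b)) * ((zsym (- b - b))^-1 *
   \prod_(a in D) (zratio (- b) (v a) * zratio b (v a)))) = 1.
  by rewrite E1 P1 mulr1 mul1r Z1.
rewrite V1 mul1r in jG.
apply: (jet_eq (jetZ (weight N D v) (jetM jet_pole_zsym jG))); first by ring.
(* The factors [zfun (- (2 * x))] and the inverse of [zsym (x - b)] together contribute -1 to the
   rate, by the reflection of [zfun] at [2 * b]. *)
rewrite /pole_rate; move: (\sum_(a in D) _) => S.
by rewrite e2 e3 (zfunN reg2); ring.
Qed.

(** The double pole is opposite to that of [jet_term00]. In the residue, the two [hsum] hidden in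
    [pole_rate] and the two sums of [ddlogz] recombine into the block sums with [be] at [b] and at
    [- b]. *)
Lemma jet_term11 : jet (- b) (fun x => (x - (- b)) ^+ 2 *
    (weight N (al |: (be |: D)) [eta v with al |-> x] *
     block_sum (al |: (be |: D)) B [eta v with al |-> x]))
  (- (weight N D v * block_sum D B v))
  (weight N D v * (block_sum D (be |: B) v + block_sum D (be |: B) v'
     + (2 * N)%:R * block_sum D B v)).
Proof.
pose f (x : C) := (x - (- b)) ^+ 2 * weight N (al |: (be |: D)) [eta v with al |-> x] *
     block_sum (al |: (be |: D)) B [eta v with al |-> x].
apply: (@jet_ext _ _ f) => [x|]; first by rewrite /f mulrA.
apply: (jet_eq (jetM jet_weight_both jet_block_sum_both)); first by rewrite mulNr.
rewrite /v' (block_sum_upd v (- b) beD beB) (block_sum_setU1 D v beB) vb.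
have -> : \sum_(y in B) - (ddlogz (b + v y) + ddlogz (- b + v y)) * block_sum D (B :\ y) v =
  - (\sum_(y in B) ddlogz (b + v y) * block_sum D (B :\ y) v
     + \sum_(y in B) ddlogz (- b + v y) * block_sum D (B :\ y) v).
  by rewrite -big_split /= -sumrN; apply: eq_bigr => y _; ring.
have H := hsumN regular_D reg2.
have S : pole_rate = - (2 * N)%:R - (hsum D v b + hsum D v (- b)).
  rewrite H /pole_rate opprD addrA -sumrN; apply: (congr1 (fun z => - (2 * N)%:R - 1 + z)).
  apply: eq_bigr => a aD; have [h1 h2] := regular_D aD.
  have -> : - b - v a = - (b + v a) by ring.
  have -> : - b + v a = - (b - v a) by ring.
  by rewrite (zfunN h1) (zfunN h2); ring.
by rewrite S; ring.
Qed.

End Terms.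

(** * The two kinds of summand as [al] tends to 0 *)

Section TermsAtZero.
Variables (R : realType) (T : finType).
Local Notation C := (Cplx R).
Variables (N : nat) (D B : {set T}) (al : T) (v : T -> C).
Hypotheses (alD : al \notin D) (alB : al \notin B).
Hypothesis reg : forall a, a \in D :|: B -> cexp (v a) != 1.

Lemma regular_zeroD a : a \in D -> cexp (0 - v a) != 1 /\ cexp (0 + v a) != 1.
Proof.
move=> aD; have h : cexp (v a) != 1 by apply: reg; rewrite finset.in_setU aD.
by rewrite sub0r add0r; split=> //; apply: regular_opp h _.
Qed.

Lemma regular_zeroB a : a \in B -> cexp (v a) != 1.
Proof. by move=> aB; apply: reg; rewrite finset.in_setU aB orbT. Qed.

(** The only pole is that of [dlogz (2 * x)] in the singleton block of [al], with residue -1/2. *)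
Lemma jet_zero_out : jet (0 : C) (fun x => (x - 0) ^+ 2 *
    (weight N D [eta v with al |-> x] * block_sum D (al |: B) [eta v with al |-> x]))
  0 (- (weight N D v * block_sum D B v) / 2).
Proof.
Transparent hsum.
pose h (x : C) := \sum_(d in D) (dlogz (x - v d) - dlogz (x + v d)).
pose f (x : C) := weight N D v * (
  (x - 0) ^+ 2 * (h x * block_sum D B v
     + \sum_(y in B) ddlogz (x + v y) * block_sum D (B :\ y) v)
  + (x - 0) * ((x - 0) * dlogz (2 * x)) * block_sum D B v).
apply: (@jet_ext _ _ f).
  move=> x; rewrite /f (eq_weight N (upd_off v x alD)) (block_sum_upd v x alD alB).
  have -> : hsum D v x = h x + dlogz (2 * x) by [].
  by ring.
Opaque hsum.
have jh : jet0 0 h (h 0).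
  apply: jet0_sum => d /regular_zeroD[r1 r2].
  have uE (x : C) : x - v d = 1 * x + - v d by ring.
  have uE' (x : C) : x + v d = 1 * x + v d by ring.
  exact: jet0B (jet0_dlogz uE (erefl _) r1) (jet0_dlogz uE' (erefl _) r2).
have jS : jet0 (0 : C) (fun x => \sum_(y in B) ddlogz (x + v y) * block_sum D (B :\ y) v)
    (\sum_(y in B) ddlogz (v y) * block_sum D (B :\ y) v).
  apply: jet0_sum => y yB; have uE (x : C) : x + v y = 1 * x + v y by ring.
  exact: jet0M (jet0_ddlogz uE (add0r _) (regular_zeroB yB)) (jet0_cst _ _).
have n2 : 2 != 0 :> C by rewrite pnatr_eq0.
have uE (x : C) : 2 * x = 2 * (x - 0) by rewrite subr0.
have j1 := jet0D (jet0M jh (jet0_cst 0 (block_sum D B v))) jS.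
apply: (jet_eq (jetZ _ (jetD (jet_eps2 j1)
  (jetM (jetM (jet_eps _) (jet_dlogz_pole n2 uE)) (jet_cst _ (block_sum D B v)))))).
  by ring.
by field.
Qed.

(** A variable of value 0 in [D] adds [dlogz (v y) - dlogz (v y) = 0] to each singleton block. *)
Lemma jet0_block_sum_zero :
  jet0 (0 : C) (fun x => block_sum (al |: D) B [eta v with al |-> x]) (block_sum D B v).
Proof.
Transparent block_sum.
apply: jet0_pair_sum => [y yB|x y z yB zB yz]; last first.
  by rewrite !Hblock2 // (upd_off v x alB yB) (upd_off v x alB zB).
Opaque block_sum.
pose f (x : C) := dlogz (v y - x) - dlogz (v y + x) + hsum D v (v y).
apply: (@jet0_ext _ _ f).
  move=> x; rewrite /f Hblock1 (hsum_setU1 _ _ alD) upd_at (upd_off v x alB yB).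
  by rewrite (eq_hsum _ (upd_off v x alD)).
have uE (x : C) : v y - x = -1 * x + v y by ring.
have uE' (x : C) : v y + x = 1 * x + v y by ring.
have j := jet0D (jet0B (jet0_dlogz uE (subr0 _) (regular_zeroB yB))
  (jet0_dlogz uE' (addr0 _) (regular_zeroB yB))) (jet0_cst _ (hsum D v (v y))).
by rewrite Hblock1; move: j; rewrite (subrr (dlogz (v y))) add0r; apply.
Qed.

(** The pole of [zfun (- (2 * x))] has residue -1/2 and the weight changes sign with the size of
    [D]. The cofactor [G] tends to 1 because [zsym] is even. *)
Lemma jet_zero_in : jet (0 : C) (fun x => (x - 0) ^+ 2 *
    (weight N (al |: D) [eta v with al |-> x] * block_sum (al |: D) B [eta v with al |-> x]))
  0 (weight N D v * block_sum D B v / 2).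
Proof.
pose G (x : C) := cexp (- ((2 * N)%:R * x)) * \prod_(a in D) zratio x (v a).
pose f (x : C) := - weight N D v * ((x - 0) * ((x - 0) * zfun (- (2 * x))) * (G x *
   block_sum (al |: D) B [eta v with al |-> x])).
apply: (@jet_ext _ _ f).
  by move=> x; rewrite /f /G (weight_upd N v x alD); ring.
have n2 : -2 != 0 :> C by rewrite oppr_eq0 pnatr_eq0.
have uE (x : C) : - (2 * x) = -2 * (x - 0) by ring.
have cE (x : C) : - ((2 * N)%:R * x) = - (2 * N)%:R * x + 0 by ring.
have c0 : cexp (- ((2 * N)%:R * 0)) = 1 :> C by rewrite mulr0 oppr0; exact: cexp0.
have jG : jet0 0 G 1.
  have -> : 1 = cexp (- ((2 * N)%:R * 0)) * \prod_(a in D) zratio 0 (v a).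
    rewrite c0 mul1r big1 // => a aD; have [_ h] := regular_zeroD aD.
    have -> : zratio 0 (v a) = zsym (0 + v a) / zsym (0 - v a) by [].
    by rewrite sub0r zsymN add0r divff // zsym_neq0 //; move: h; rewrite add0r.
  apply: (jet0M (jet0_cexp cE (erefl _))).
  by apply: jet0_prod => a /regular_zeroD[h1 h2]; exact: jet0_zratio.
have [g jGM] := jet0M jG jet0_block_sum_zero.
apply: (jet_eq (jetZ _ (jetM (jetM (jet_eps _) (jet_zfun_pole n2 uE)) jGM))).
  by ring.
by field.
Qed.

End TermsAtZero.

(** * Summation over all subsets *)

Section Assembly.
Variables (R : realType) (T : finType).
Local Notation C := (Cplx R).
Implicit Types (A B D : {set T}) (v : T -> C) (t : T).

Lemma setDU1_out B D t : t \notin D -> (t |: B) :\: D = t |: (B :\: D).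
Proof.
by move=> tD; apply/setP => x; rewrite !inE; have [->|] := eqVneq x t; rewrite ?tD.
Qed.

Lemma setDU1_in B D t : t \notin B -> (t |: B) :\: (t |: D) = B :\: D.
Proof.
move=> tB; apply/setP => x; rewrite !inE; have [->|//] := eqVneq x t.
by rewrite (negbTE tB) andbF.
Qed.

Lemma Jstar_setU1 N B t v : t \notin B -> generic (t |: B) v ->
  Jstar N (t |: B) v =
  \sum_(D : {set T} | D \subset B)
    (weight N D v * block_sum D (t |: (B :\: D)) v
     + weight N (t |: D) v * block_sum (t |: D) (B :\: D) v).
Proof.
move=> tB gv; rewrite (Jstar_weight N gv) (sum_subset_setU1 _ tB).
apply: eq_bigr => D DB; have tD : t \notin D by apply: contra tB; exact: (fintype.subsetP DB).
by rewrite (setDU1_out B tD) (setDU1_in D tB).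
Qed.

(** A sign change of one variable exchanges conditions on sums with conditions on differences, up to
    sign. *)
Lemma generic_flip D v t : generic D v -> generic D [eta v with t |-> - v t].
Proof.
move=> [g1 g2]; split=> a b aD bD.
  rewrite /=; case: (eqVneq a t) => [E|nat0]; case: (eqVneq b t) => [E'|nbt].
  - by subst a; apply: regular_opp (g1 t t aD aD) _; ring.
  - have bt : b != t by [].
    by subst a; apply: regular_opp (g2 t b aD bD _) _; [rewrite eq_sym | ring].
  - by subst b; exact: g2.
  - exact: g1.
move=> ab; rewrite /=; case: (eqVneq a t) => [E|_]; case: (eqVneq b t) => [E'|_].
- by rewrite E E' eqxx in ab.
- by subst a; apply: regular_opp (g1 t b aD bD) _; ring.
- by subst b; rewrite opprK; exact: g1.
- exact: g2.
Qed.

Lemma jet_sum_subset B (c : C) (f : {set T} -> C -> C) (a b : {set T} -> C) :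
  (forall D, D \subset B -> jet c (fun x => (x - c) ^+ 2 * f D x) (a D) (b D)) ->
  jet c (fun x => (x - c) ^+ 2 * \sum_(D : {set T} | D \subset B) f D x)
    (\sum_(D : {set T} | D \subset B) a D) (\sum_(D : {set T} | D \subset B) b D).
Proof.
by move=> h; apply: jet_ext (jet_sum _ h) => x; rewrite big_distrr.
Qed.

Lemma residue_zero N B al v : al \notin B -> generic B v ->
  has_residue (fun x => Jstar N (al |: B) [eta v with al |-> x]) 0 0.
Proof.
move=> alB gv.
have gB : generic ((al |: B) :\ al) v by rewrite setU1K.
pose J D x := weight N D [eta v with al |-> x] * block_sum D (al |: (B :\: D)) [eta v with al |-> x]
  + weight N (al |: D) [eta v with al |-> x] * block_sum (al |: D) (B :\: D) [eta v with al |-> x].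
have j : jet (0 : C) (fun x => (x - 0) ^+ 2 * \sum_(D : {set T} | D \subset B) J D x)
    (\sum_(D : {set T} | D \subset B) 0) (\sum_(D : {set T} | D \subset B) 0).
  apply: jet_sum_subset => D DB.
  have alD : al \notin D by apply: contra alB; exact: (fintype.subsetP DB).
  have alE : al \notin B :\: D by rewrite finset.in_setD (negbTE alB) andbF.
  have reg a : a \in D :|: (B :\: D) -> cexp (v a) != 1.
    move=> aU; have aB : a \in B.
      by move: aU; rewrite !inE => /orP[/(fintype.subsetP DB)|/andP[]].
    have [g1 _] := gv; apply: contra (g1 a a aB aB) => /eqP E.
    by rewrite cexpD E mulr1.
  (* For each [D], the terms with and without [al] have opposite residues. *)
  have := jetD (jet_zero_out N alD alE reg) (jet_zero_in N alD alE reg).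
  rewrite addr0 mulNr addNr; apply: jet_ext => x.
  by rewrite /J mulrDr.
apply: (@jet_residue _ _ _ (\sum_(D : {set T} | D \subset B) 0)).
rewrite [X in jet _ _ _ X](_ : _ = \sum_(D : {set T} | D \subset B) (0 : C)); last by rewrite big1.
(* The formula for [Jstar] through [root_fun] holds at generic valuations, hence on a punctured
   neighbourhood, which is all that an expansion sees. *)
apply: jet_near j; apply: filterS (near_generic (0 : C) gB) => x gx.
by rewrite (Jstar_setU1 N alB gx).
Qed.

Lemma residue_opp N B al be v : al \notin B -> be \notin B -> al != be ->
  generic (be |: B) v ->
  has_residue (fun x => Jstar N (al |: (be |: B)) [eta v with al |-> x]) (- v be)
    (Jstar N (be |: B) v + Jstar N (be |: B) [eta v with be |-> - v be]
     + (2 * N)%:R * Jstar N B v).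
Proof.
move=> alB beB ab gv.
have alBe : al \notin be |: B by rewrite finset.in_setU1 (negbTE ab).
have gA : generic ((al |: (be |: B)) :\ al) v by rewrite setU1K.
have gB : generic B v by apply: generic_sub gv; exact: finset.subsetUr.
pose v' : T -> C := [eta v with be |-> - v be].
have gv' : generic (be |: B) v' by exact: generic_flip.
pose u x : T -> C := [eta v with al |-> x].
pose t D E x := weight N D (u x) * block_sum D E (u x).
(* The four summands whose subset meets the variables other than [al] and [be] in [D]; [r D] is
   their total residue. *)
pose J D x := (t D (al |: (be |: (B :\: D))) x + t (be |: D) (al |: (B :\: D)) x)
  + (t (al |: D) (be |: (B :\: D)) x + t (al |: (be |: D)) (B :\: D) x).
pose r D := weight N (be |: D) v * block_sum (be |: D) (B :\: D) v
  + weight N (be |: D) v' * block_sum (be |: D) (B :\: D) v'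
  + weight N D v * (block_sum D (be |: (B :\: D)) v + block_sum D (be |: (B :\: D)) v'
     + (2 * N)%:R * block_sum D (B :\: D) v).
have j : jet (- v be) (fun x => (x - - v be) ^+ 2 * \sum_(D : {set T} | D \subset B) J D x)
    (\sum_(D : {set T} | D \subset B) 0) (\sum_(D : {set T} | D \subset B) r D).
  apply: jet_sum_subset => D DB.
  have sD a : a \in D -> a \in B by exact: (fintype.subsetP DB).
  have alD : al \notin D by apply: contra alB; exact: sD.
  have beD : be \notin D by apply: contra beB; exact: sD.
  have alE : al \notin B :\: D by rewrite finset.in_setD (negbTE alB) andbF.
  have beE : be \notin B :\: D by rewrite finset.in_setD (negbTE beB) andbF.
  have [g1 g2] := gv.
  have beIn : be \in be |: B by exact: setU11.
  have reg a : a \in D :|: (B :\: D) -> cexp (v be - v a) != 1 /\ cexp (v be + v a) != 1.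
    move=> aU; have aB : a \in B by move: aU; rewrite !inE => /orP[/sD|/andP[]].
    have aIn : a \in be |: B by rewrite finset.in_setU1 aB orbT.
    split; last exact: g1.
    by apply: g2 => //; apply: contraNneq beB => ->.
  have reg2 : cexp (2 * v be) != 1.
    have -> : 2 * v be = v be + v be by ring.
    exact: g1.
  have j00 := jet_term00 N alD alE beE ab (erefl (v be)) reg reg2.
  have j01 := jet_term01 N alD alE beD ab (erefl (v be)) reg reg2.
  have j10 := jet_term10 N alD alE beD beE ab (erefl (v be)) reg reg2.
  have j11 := jet_term11 N alD alE beD beE ab (erefl (v be)) reg reg2.
  (* The double poles of the first and the last summand cancel, so the leading coefficient is 0. *)
  have jj := jet_eq (jetD (jetD j00 j01) (jetD j10 j11)).
  apply: (jet_ext _ (jj 0 (r D) _ _)).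
  - by move=> x; rewrite /J /t /u !mulrDr.
  - by ring.
  - by rewrite add0r addrA.
(* Splitting the first two values of [Jstar] by whether [be] is in the subset gives [r D] for each
   [D]; when it is not, the weight does not see the sign of [v be]. *)
have E : Jstar N (be |: B) v + Jstar N (be |: B) v' + (2 * N)%:R * Jstar N B v =
    \sum_(D : {set T} | D \subset B) r D.
  rewrite (Jstar_setU1 N beB gv) (Jstar_setU1 N beB gv') (Jstar_weight N gB).
  rewrite big_distrr -!big_split /=; apply: eq_bigr => D DB.
  have beD : be \notin D by apply: contra beB; exact: (fintype.subsetP DB).
  have -> : weight N D v' = weight N D v by exact: eq_weight (upd_off v _ beD).
  rewrite /r.
  move: (weight N (be |: D) v) (weight N (be |: D) v') (weight N D v) => w1 w2 w0.
  move: (block_sum (be |: D) _ v) (block_sum (be |: D) _ v') => m1 m2.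
  move: (block_sum D (be |: _) v) (block_sum D (be |: _) v') (block_sum D (B :\: D) v) => m3 m4 m0.
  by ring.
rewrite -/v' E; apply: jet_residue.
apply: jet_near j; apply: filterS (near_generic (- v be) gA) => x gx.
apply: (congr1 (fun z => (x - - v be) ^+ 2 * z)).
rewrite (Jstar_setU1 N alBe gx) (sum_subset_setU1 _ beB).
apply: eq_bigr => D DB.
have beD : be \notin D by apply: contra beB; exact: (fintype.subsetP DB).
rewrite (setDU1_out B beD) (setDU1_in D beB).
by rewrite /J /t /u addrACA.
Qed.

End Assembly.

Theorem theorem3p4 (R : realType) (T : finType) (N : nat) (HN : (0 < N)%N)
    (A : {set T}) (alpha : T) (Halpha : alpha \in A) (v : T -> Cplx R)
    (Hv : generic (A :\ alpha) v) :
  (forall beta : T, beta \in A -> beta != alpha ->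
     let A' := A :\ alpha :\ beta in
     has_residue (fun x => Jstar N A [eta v with alpha |-> x]) (- v beta)
       (Jstar N (beta |: A') v
        + Jstar N (beta |: A') [eta v with beta |-> - v beta]
        + (2 * N)%:R * Jstar N A' v)) /\
  has_residue (fun x => Jstar N A [eta v with alpha |-> x]) 0 0.
Proof.
have alA : alpha \notin A :\ alpha by rewrite setD11.
split; last by rewrite -{1}(finset.setD1K Halpha); exact: residue_zero.
move=> beta betaA ba A'.
have betaA1 : beta \in A :\ alpha by rewrite !inE ba.
have E : A = alpha |: (beta |: A') by rewrite /A' (finset.setD1K betaA1) (finset.setD1K Halpha).
have alA' : alpha \notin A' by rewrite !inE eqxx andbF.
have beA' : beta \notin A' by rewrite setD11.
have gA' : generic (beta |: A') v by rewrite (finset.setD1K betaA1).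
rewrite {1}E; apply: residue_opp => //.
by rewrite eq_sym.
Qed.
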